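(* Let $g\in H(\mathbb D)$ and $\alpha,\beta\geq0$. Then: (1) $S_g: H^{\infty}_\alpha\rightarrow H^{\infty}_0$ is compact if and only if $g\equiv0$; (2) if $\beta>0$, then $S_g: H^{\infty}_\alpha\rightarrow H^{\infty}_\beta$ is compact if and only if $$\lim_{|z|\rightarrow1^-}(1-|z|^2)^{\beta-\alpha}|g(z)|=0\,.$$
   Context: $\mathbb D$ is the open unit disk and $H(\mathbb D)$ the space of analytic functions on $\mathbb D$. For $\alpha\geq0$, $H^{\infty}_\alpha=\{f\in H(\mathbb D): \|f\|_{H^\infty_\alpha}:=\sup_{z\in\mathbb D}(1-|z|^2)^\alpha|f(z)|<\infty\}$; $H^\infty_0$ is the space of bounded analytic functions with sup norm. For $g\in H(\mathbb D)$, $(S_gf)(z)=\int_0^z f'(\omega)g(\omega)\,d\omega$. *)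

(* Defs.v *)
From Stdlib Require Import Reals Lra.
Open Scope R_scope.

Definition Cx : Type := (R * R)%type.
Definition Cadd (z w : Cx) : Cx := (fst z + fst w, snd z + snd w).
Definition Csub (z w : Cx) : Cx := (fst z - fst w, snd z - snd w).
Definition Cmul (z w : Cx) : Cx :=
  (fst z * fst w - snd z * snd w, fst z * snd w + snd z * fst w).
Definition C0 : Cx := (0, 0).
Definition Cmod (z : Cx) : R := sqrt (fst z * fst z + snd z * snd z).

Definition inD (z : Cx) : Prop := Cmod z < 1.

Definition has_cderiv (f : Cx -> Cx) (z l : Cx) : Prop :=
  forall eps : R, 0 < eps -> exists delta : R, 0 < delta /\
    forall h : Cx, 0 < Cmod h < delta ->
      Cmod (Csub (Csub (f (Cadd z h)) (f z)) (Cmul l h)) <= eps * Cmod h.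

Definition holoD (f : Cx -> Cx) : Prop :=
  forall z : Cx, inD z -> exists l : Cx, has_cderiv f z l.

(* the weight (1 - |z|^2)^a (base is > 0 on D) *)
Definition weight (a : R) (z : Cx) : R := Rpower (1 - Cmod z ^ 2) a.

Definition in_Hinf (a : R) (f : Cx -> Cx) : Prop :=
  holoD f /\ exists M : R, forall z : Cx, inD z -> weight a z * Cmod (f z) <= M.

(* h = S_g f, i.e. h(z) = int_0^z f'(w) g(w) dw: h is the primitive of f' g
   on D vanishing at 0 (D is convex, so this is the path integral). *)
Definition IsSg (g f h : Cx -> Cx) : Prop :=
  h C0 = C0 /\
  forall z : Cx, inD z -> exists l : Cx, has_cderiv f z l /\ has_cderiv h z (Cmul l (g z)).

Definition Sg_compact (g : Cx -> Cx) (a b : R) : Prop :=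
  (forall f h : Cx -> Cx, in_Hinf a f -> IsSg g f h -> in_Hinf b h) /\
  (forall (fs hs : nat -> Cx -> Cx) (M : R),
     (forall n, holoD (fs n)) ->
     (forall n z, inD z -> weight a z * Cmod (fs n z) <= M) ->
     (forall n, IsSg g (fs n) (hs n)) ->
     exists (phi : nat -> nat) (h : Cx -> Cx),
       (forall n, (phi n < phi (S n))%nat) /\ in_Hinf b h /\
       forall eps : R, 0 < eps -> exists N : nat, forall n : nat, (N <= n)%nat ->
         forall z : Cx, inD z -> weight b z * Cmod (Csub (hs (phi n) z) (h z)) <= eps).

Definition weighted_lim0 (g : Cx -> Cx) (a b : R) : Prop :=
  forall eps : R, 0 < eps -> exists r : R, r < 1 /\
    forall z : Cx, r < Cmod z < 1 -> weight (b - a) z * Cmod (g z) < eps.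

(* Main.v *)
Require Import Defs.
From Stdlib Require Import Reals Lra Lia Psatz ClassicalEpsilon List.
From Coquelicot Require Import Coquelicot.
Open Scope R_scope.

(** Necessity: the functions [n^alpha z^n] are bounded in the [alpha]-norm and tend to 0 locally uniformly,
    so along a compact [S_g] their images tend to 0 in the [beta]-norm; by the weighted Cauchy estimate
    [(1-|z|^2)^(beta+1) |n^(alpha+1) z^(n-1) g(z)|] is then small, and on the circles [1-|z| ~ 1/n] this
    quantity is comparable to [(1-|z|^2)^(beta-alpha) |g(z)|]. For [beta = 0] it follows that [g] tends to 0
    at the boundary, hence vanishes.
    Sufficiency: a bounded sequence has a locally uniformly Cauchy subsequence [f_n] (Montel). In
    [(f_n - f_m)' g] the derivative is uniformly small on a compact disc, while near the boundary the whole
    product is [o((1-|z|)^(-beta-1))], which integrates to [o((1-|z|)^(-beta))] because [beta > 0].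
    All of this rests on the Cauchy estimate, obtained from Goursat's theorem on rectangles. *)

(* Coquelicot's [C] and its ring operations are convertible to [Cx] and its operations; only the moduli differ.
   Below, [Cmod] is Coquelicot's. *)

(** * Complex derivatives *)

(** Both directions rest on one splitting, (1-|z|^2)^(beta+1) = (1-|z|^2)^(alpha+1)
    (1-|z|^2)^(beta-alpha): the first factor belongs to f', the second to g. Sufficiency bounds the
    f' part by the Cauchy estimate; necessity uses that this estimate is sharp, up to a constant, at
    every point near the circle for a suitable power of z. The coefficient n^alpha is forced, since
    the maximum of (1-r^2)^alpha r^n is of order n^(-alpha). For beta = 0 the integral of
    (1-t)^(-beta-1) is a logarithm instead of a bounded multiple of (1-t)^(-beta), which is why that
    case is separate. Only orders of magnitude matter, so the constants are crude throughout. In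
    sufficiency a limit is formed only for the images; the [f_n] enter through their differences. As
    [IsSg] is a relation, necessity must also exhibit the images of its test functions, hence the
    construction of primitives. *)

Lemma Cmod_Complex (z : C) : Defs.Cmod z = Cmod z.
Proof. unfold Cmod, Defs.Cmod. f_equal. ring. Qed.

Lemma has_cderivP (f : C -> C) (z l : C) :
  has_cderiv f z l <->
  forall eps, 0 < eps -> exists delta, 0 < delta /\
    forall h : C, Cmod h < delta ->
      (Cmod (f (z + h) - f z - l * h) <= eps * Cmod h)%C.
Proof.
split; intros H eps Heps; destruct (H eps Heps) as [d [Hd H1]];
  exists d; split; auto; intros h Hh.
- destruct (Req_dec (Cmod h) 0) as [E|E].
  + apply Cmod_eq_0 in E. subst h.
    replace (z + 0)%C with z by ring.
    replace (f z - f z - l * 0)%C with (RtoC 0) by ring. rewrite Cmod_0. lra.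
  + specialize (H1 h). rewrite !Cmod_Complex in H1. apply H1.
    generalize (Cmod_ge_0 h); lra.
- rewrite !Cmod_Complex in *. apply H1. lra.
Qed.

(** Opens the way to Coquelicot's product, difference and chain rules, with [C] as a normed module
    over itself. *)
Lemma has_cderiv_is_derive (f : C -> C) (z l : C) :
  has_cderiv f z l <->
  is_derive (K := C_AbsRing) (V := AbsRing_NormedModule C_AbsRing) f z l.
Proof.
rewrite has_cderivP. split.
- intros H. split. apply is_linear_scal_l.
  intros x Hx. assert (x = z) as ->.
  { symmetry. apply (is_filter_lim_locally_unique (K:=C_AbsRing)
      (V:=AbsRing_NormedModule C_AbsRing) z x Hx). }
  intros eps. destruct (H eps (cond_pos eps)) as [d [Hd H1]].
  exists (mkposreal d Hd). intros y Hy.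
  change C in (type of y).
  change (Cmod (y - z)%C < d) in Hy.
  change (Cmod (f y - f z - (y - z) * l)%C <= eps * Cmod (y - z)%C).
  specialize (H1 (y - z)%C Hy).
  replace (f y - f z - (y - z) * l)%C with (f (z + (y - z)) - f z - l * (y - z))%C.
  exact H1. replace (z + (y - z))%C with y by ring. ring.
- intros [_ H] eps Heps. specialize (H z (fun P HP => HP) (mkposreal eps Heps)).
  destruct H as [d H].
  exists d. split. apply cond_pos. intros h Hh.
  specialize (H (z + h)%C).
  change (Cmod (z + h - z)%C < d -> Cmod (f (z+h) - f z - (z + h - z) * l)%C
    <= eps * Cmod (z+h - z)%C) in H.
  replace (z + h - z)%C with h in H by ring.
  replace (f (z + h) - f z - l * h)%C with (f (z+h) - f z - h * l)%C by ring.
  auto.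
Qed.

Lemma has_cderiv_mul (f g : C -> C) (z a b : C) :
  has_cderiv f z a -> has_cderiv g z b ->
  has_cderiv (fun w => f w * g w)%C z (a * g z + f z * b)%C.
Proof.
rewrite !has_cderiv_is_derive. intros H1 H2.
exact (is_derive_mult (K:=C_AbsRing) f g z a b H1 H2 Cmult_comm).
Qed.

Lemma has_cderiv_sub (f g : C -> C) (z a b : C) :
  has_cderiv f z a -> has_cderiv g z b ->
  has_cderiv (fun w => f w - g w)%C z (a - b)%C.
Proof.
rewrite !has_cderiv_is_derive. intros H1 H2.
exact (is_derive_minus (K:=C_AbsRing) (V:=AbsRing_NormedModule C_AbsRing) f g z a b H1 H2).
Qed.

Lemma has_cderiv_comp (f g : C -> C) (z a b : C) :
  has_cderiv f (g z) a -> has_cderiv g z b ->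
  has_cderiv (fun w => f (g w))%C z (a * b)%C.
Proof.
rewrite !has_cderiv_is_derive. intros H1 H2.
replace (a * b)%C with (b * a)%C by ring.
exact (is_derive_comp (K:=C_AbsRing) (V:=AbsRing_NormedModule C_AbsRing) f g z a b H1 H2).
Qed.

Lemma has_cderiv_const (a z : C) : has_cderiv (fun _ => a) z (RtoC 0).
Proof.
apply has_cderiv_is_derive.
exact (is_derive_const (K:=C_AbsRing) (V := AbsRing_NormedModule C_AbsRing) a z).
Qed.

Lemma has_cderiv_id (z : C) : has_cderiv (fun w => w) z (RtoC 1).
Proof.
apply has_cderiv_is_derive. exact (is_derive_id (K:=C_AbsRing) z).
Qed.

Lemma has_cderiv_ext_loc (f g : C -> C) (z l : C) (r : R) : 0 < r ->
  (forall w, Cmod (w - z) < r -> f w = g w) -> has_cderiv f z l -> has_cderiv g z l.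
Proof.
intros Hr E. rewrite !has_cderivP. intros H eps Heps.
destruct (H eps Heps) as [d [Hd H1]]. exists (Rmin d r).
split. now apply Rmin_glb_lt. intros h Hh.
rewrite <- !E. apply H1. eapply Rlt_le_trans; [apply Hh|apply Rmin_l].
replace (z - z)%C with (RtoC 0) by ring. rewrite Cmod_0; lra.
replace (z + h - z)%C with h by ring. eapply Rlt_le_trans; [apply Hh|apply Rmin_r].
Qed.

Lemma Cmod_sub_le (a b : C) : Cmod a - Cmod b <= Cmod (a + b).
Proof.
pose proof (Cmod_triangle (a + b)%C (- b)%C) as H.
rewrite Cmod_opp in H. replace (a + b + - b)%C with a in H by ring. lra.
Qed.

Lemma has_cderiv_inv (z : C) : z <> RtoC 0 -> has_cderiv (fun w => / w)%C z (- / (z * z))%C.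
Proof.
intros Hz. apply has_cderivP. intros eps Heps.
assert (P : 0 < Cmod z) by now apply Cmod_gt_0.
(* The remainder is exactly h^2 / (z^2 (z + h)). The first bound keeps |z + h| >= |z|/2, so the
   denominator is at least |z|^3 / 2; the second makes |h| at most [eps] times that. *)
exists (Rmin (Cmod z / 2) (eps * Cmod z ^ 3 / 2)).
assert (P3 : 0 < Cmod z ^ 3) by now apply pow_lt.
split. apply Rmin_glb_lt. lra. apply Rdiv_lt_0_compat; nra.
intros h Hh.
pose proof (Rlt_le_trans _ _ _ Hh (Rmin_l _ _)) as Hh1.
pose proof (Rlt_le_trans _ _ _ Hh (Rmin_r _ _)) as Hh2.
pose proof (Cmod_sub_le z h) as Q.
assert (N : (z + h)%C <> RtoC 0) by (apply Cmod_gt_0; lra).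
replace (/ (z + h) - / z - - / (z * z) * h)%C with (h * h / (z * z * (z + h)))%C
  by (field; auto).
assert (N2 : (z * z * (z + h))%C <> RtoC 0) by (repeat apply Cmult_neq_0; auto).
rewrite Cmod_div, !Cmod_mult by auto.
assert (D : Cmod z ^ 3 / 2 <= Cmod z * Cmod z * Cmod (z + h)) by (simpl; nra).
pose proof (Cmod_ge_0 h).
apply Rle_div_l. lra.
assert (eps * (Cmod z ^ 3 / 2) <= eps * (Cmod z * Cmod z * Cmod (z + h)))
  by (apply Rmult_le_compat_l; lra).
nra.
Qed.

Lemma has_cderiv_cont (f : C -> C) (z l : C) : has_cderiv f z l ->
  forall eps, 0 < eps -> exists delta, 0 < delta /\
    forall h, Cmod h < delta -> Cmod (f (z + h) - f z)%C < eps.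
Proof.
rewrite has_cderivP. intros H eps Heps. destruct (H 1 Rlt_0_1) as [d [Hd H1]].
pose proof (Cmod_ge_0 l).
assert (Q : 0 < eps / (2 + Cmod l)) by (apply Rdiv_lt_0_compat; lra).
exists (Rmin d (eps / (2 + Cmod l))). split. now apply Rmin_glb_lt.
intros h Hh.
pose proof (Rlt_le_trans _ _ _ Hh (Rmin_l _ _)) as Hh1.
pose proof (Rlt_le_trans _ _ _ Hh (Rmin_r _ _)) as Hh2.
specialize (H1 h Hh1).
pose proof (Cmod_triangle (f (z + h) - f z - l * h)%C (l * h)%C) as T.
replace (f (z + h) - f z - l * h + l * h)%C with (f (z + h) - f z)%C in T by ring.
rewrite Cmod_mult in T.
apply Rlt_div_r in Hh2; [|lra]. pose proof (Cmod_ge_0 h). nra.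
Qed.

(** * Derivatives along real paths *)

Lemma is_deriveP (f : R -> R) (x l : R) :
  is_derive f x l <->
  forall eps, 0 < eps -> exists delta, 0 < delta /\
    forall h, Rabs h < delta -> Rabs (f (x + h) - f x - l * h) <= eps * Rabs h.
Proof.
rewrite is_derive_Reals. split.
- intros H eps Heps. destruct (H eps Heps) as [d Hd].
  exists d. split. apply cond_pos. intros h Hh.
  destruct (Req_dec h 0) as [->|N].
  + rewrite Rplus_0_r, Rabs_R0. replace (f x - f x - l * 0) with 0 by ring.
    rewrite Rabs_R0; lra.
  + specialize (Hd h N Hh).
    replace (f (x + h) - f x - l * h) with (((f (x + h) - f x) / h - l) * h) by (field; auto).
    rewrite Rabs_mult. apply Rmult_le_compat_r. apply Rabs_pos. lra.
- intros H eps Heps. destruct (H (eps / 2)) as [d [Hd H1]]. lra.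
  exists (mkposreal d Hd). intros h N Hh. specialize (H1 h Hh).
  replace (f (x + h) - f x - l * h) with (((f (x + h) - f x) / h - l) * h) in H1 by (field; auto).
  rewrite Rabs_mult in H1. pose proof (Rabs_pos_lt h N).
  apply Rmult_le_reg_r in H1; lra.
Qed.

(** Componentwise, so that real mean value and integration theorems apply directly;
    [is_path_deriveP] recovers the form with the modulus. *)
Definition is_path_derive (p : R -> C) (t : R) (v : C) : Prop :=
  is_derive (fun s => fst (p s)) t (fst v) /\ is_derive (fun s => snd (p s)) t (snd v).

Lemma Cmod_le_sum (z : C) : Cmod z <= Rabs (fst z) + Rabs (snd z).
Proof.
unfold Cmod. apply Rsqr_incr_0_var.
- rewrite Rsqr_sqrt by nra. unfold Rsqr.
  pose proof (Rabs_pos (fst z)). pose proof (Rabs_pos (snd z)).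
  rewrite <- (pow2_abs (fst z)), <- (pow2_abs (snd z)). nra.
- generalize (Rabs_pos (fst z)) (Rabs_pos (snd z)); lra.
Qed.

Lemma Rabs_fst_le (z : C) : Rabs (fst z) <= Cmod z.
Proof. apply Rle_trans with (2 := Rmax_Cmod z). apply Rmax_l. Qed.

Lemma Rabs_snd_le (z : C) : Rabs (snd z) <= Cmod z.
Proof. apply Rle_trans with (2 := Rmax_Cmod z). apply Rmax_r. Qed.

Lemma is_path_deriveP (p : R -> C) (t : R) (v : C) :
  is_path_derive p t v <->
  forall eps, 0 < eps -> exists delta, 0 < delta /\
    forall s, Rabs s < delta -> Cmod (p (t + s)%R - p t - v * RtoC s)%C <= eps * Rabs s.
Proof.
unfold is_path_derive. rewrite !is_deriveP. split.
- intros [H1 H2] eps Heps.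
  destruct (H1 (eps / 2)) as [d1 [Hd1 K1]]; [lra|].
  destruct (H2 (eps / 2)) as [d2 [Hd2 K2]]; [lra|].
  exists (Rmin d1 d2). split. now apply Rmin_glb_lt.
  intros s Hs.
  specialize (K1 s (Rlt_le_trans _ _ _ Hs (Rmin_l _ _))).
  specialize (K2 s (Rlt_le_trans _ _ _ Hs (Rmin_r _ _))).
  eapply Rle_trans; [apply Cmod_le_sum|].
  replace (fst (p (t + s)%R - p t - v * RtoC s)%C) with
    (fst (p (t + s)) - fst (p t) - fst v * s) by (simpl; ring).
  replace (snd (p (t + s)%R - p t - v * RtoC s)%C) with
    (snd (p (t + s)) - snd (p t) - snd v * s) by (simpl; ring).
  lra.
- intros H. split; intros eps Heps; destruct (H eps Heps) as [d [Hd K]];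
    exists d; (split; [auto|]); intros s Hs; specialize (K s Hs);
    eapply Rle_trans; try apply K.
  + eapply Rle_trans; [|apply Rabs_fst_le]. right. f_equal. simpl; ring.
  + eapply Rle_trans; [|apply Rabs_snd_le]. right. f_equal. simpl; ring.
Qed.

(** The remainder is that of [f] at the path increment [h] plus [l] times that of the path; |h| <=
    (|v| + 1) |s| turns the former into o(s). *)
Lemma is_path_derive_comp (f : C -> C) (p : R -> C) (t : R) (l v : C) :
  has_cderiv f (p t) l -> is_path_derive p t v -> is_path_derive (fun s => f (p s)) t (l * v)%C.
Proof.
rewrite has_cderivP, !is_path_deriveP. intros Hf Hp eps Heps.
pose proof (Cmod_ge_0 l) as L0. pose proof (Cmod_ge_0 v) as V0.
assert (E1 : 0 < eps / (2 * (Cmod v + 1))) by (apply Rdiv_lt_0_compat; lra).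
destruct (Hf _ E1) as [d1 [Hd1 K1]].
assert (E2 : 0 < Rmin 1 (eps / (2 * (Cmod l + 1)))).
{ apply Rmin_glb_lt. lra. apply Rdiv_lt_0_compat; lra. }
destruct (Hp _ E2) as [d2 [Hd2 K2]].
assert (E3 : 0 < d1 / (Cmod v + 1)) by (apply Rdiv_lt_0_compat; lra).
exists (Rmin d2 (d1 / (Cmod v + 1))). split. now apply Rmin_glb_lt.
intros s Hs.
specialize (K2 s (Rlt_le_trans _ _ _ Hs (Rmin_l _ _))).
pose proof (Rlt_le_trans _ _ _ Hs (Rmin_r _ _)) as Hs2.
apply Rlt_div_r in Hs2; [|lra].
set (h := (p (t + s)%R - p t)%C) in *.
pose proof (Rabs_pos s) as S0.
assert (Hh : Cmod h <= (Cmod v + 1) * Rabs s).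
{ pose proof (Cmod_triangle (h - v * RtoC s) (v * RtoC s)) as T.
  replace (h - v * RtoC s + v * RtoC s)%C with h in T by ring.
  rewrite Cmod_mult, Cmod_R in T.
  pose proof (Rmin_l 1 (eps / (2 * (Cmod l + 1)))). nra. }
specialize (K1 h ltac:(nra)).
replace (p t + h)%C with (p (t + s)%R) in K1 by (unfold h; ring).
replace (f (p (t + s)%R) - f (p t) - l * v * RtoC s)%C with
  ((f (p (t + s)%R) - f (p t) - l * h) + l * (h - v * RtoC s))%C by ring.
eapply Rle_trans; [apply Cmod_triangle|]. rewrite Cmod_mult.
assert (Q1 : Cmod (f (p (t + s)%R) - f (p t) - l * h)%C <= eps / 2 * Rabs s).
{ eapply Rle_trans; [apply K1|].
  replace (eps / 2 * Rabs s) with (eps / (2 * (Cmod v + 1)) * ((Cmod v + 1) * Rabs s))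
    by (field; lra). apply Rmult_le_compat_l; lra. }
assert (Q2 : Cmod l * Cmod (h - v * RtoC s)%C <= eps / 2 * Rabs s).
{ apply Rle_trans with ((Cmod l + 1) * (eps / (2 * (Cmod l + 1)) * Rabs s)).
  2:{ right. field. lra. }
  apply Rmult_le_compat; try lra. apply Cmod_ge_0.
  eapply Rle_trans; [apply K2|]. apply Rmult_le_compat_r; auto. apply Rmin_r. }
lra.
Qed.

(** The left side is the real part of conj(u) z. *)
Lemma inner_le (u z : C) : fst u * fst z + snd u * snd z <= Cmod u * Cmod z.
Proof.
rewrite <- (Cmod_conj u), <- Cmod_mult. eapply Rle_trans; [|apply Rabs_fst_le].
eapply Rle_trans; [|apply Rle_abs]. simpl. lra.
Qed.

Lemma Cmod_sq (z : C) : Cmod z * Cmod z = fst z * fst z + snd z * snd z.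
Proof. unfold Cmod. rewrite sqrt_sqrt. ring. nra. Qed.

(* Projecting onto the direction of the total increment reduces the estimate to the real mean value theorem. *)
Lemma path_increment_le (p v : R -> C) (psi dpsi : R -> R) (a b : R) : a <= b ->
  (forall t, a <= t <= b -> is_path_derive p t (v t)) ->
  (forall t, a <= t <= b -> is_derive psi t (dpsi t)) ->
  (forall t, a <= t <= b -> Cmod (v t) <= dpsi t) ->
  Cmod (p b - p a)%C <= psi b - psi a.
Proof.
intros Hab Hp Hpsi Hle.
assert (K : forall u : C, fst u * fst (p b - p a)%C + snd u * snd (p b - p a)%C
  <= Cmod u * (psi b - psi a)).
{ intros u.
  set (phi := fun t => fst u * fst (p t) + snd u * snd (p t) - Cmod u * psi t).
  set (dphi := fun t => fst u * fst (v t) + snd u * snd (v t) - Cmod u * dpsi t).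
  assert (D : forall t, a <= t <= b -> is_derive phi t (dphi t)).
  { intros t Ht. destruct (Hp t Ht) as [D1 D2]. specialize (Hpsi t Ht).
    unfold phi, dphi.
    apply (is_derive_minus (K:=R_AbsRing) (V:=R_NormedModule)).
    apply (is_derive_plus (K:=R_AbsRing) (V:=R_NormedModule)).
    apply (is_derive_scal (fun s => fst (p s))); auto.
    apply (is_derive_scal (fun s => snd (p s))); auto.
    apply (is_derive_scal psi); auto. }
  destruct (MVT_gen phi a b dphi) as [c [Hc E]].
  - rewrite Rmin_left, Rmax_right by auto. intros x Hx. apply D. lra.
  - rewrite Rmin_left, Rmax_right by auto. intros x Hx.
    apply continuity_pt_filterlim. apply (ex_derive_continuous phi). eexists. now apply D.
  - rewrite Rmin_left, Rmax_right in Hc by auto.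
    assert (dphi c <= 0).
    { unfold dphi. pose proof (inner_le u (v c)). specialize (Hle c Hc).
      pose proof (Cmod_ge_0 u). nra. }
    assert (phi b - phi a <= 0) by (rewrite E; nra).
    unfold phi in *. simpl. nra. }
destruct (Req_dec (Cmod (p b - p a)%C) 0) as [E|E].
(* For a vanishing increment only [psi a <= psi b] remains, which is the case [u = 1]. *)
- specialize (K (RtoC 1)). apply Cmod_eq_0 in E. rewrite E in *. rewrite Cmod_1 in K.
  rewrite Cmod_0. simpl in K. lra.
- specialize (K (p b - p a)%C). rewrite <- Cmod_sq in K.
  apply Rmult_le_reg_l in K; auto. pose proof (Cmod_ge_0 (p b - p a)). lra.
Qed.

Lemma is_path_derive_line (z k : C) (t : R) : is_path_derive (fun s => z + RtoC s * k)%C t k.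
Proof. split; simpl; auto_derive; auto; ring. Qed.

(** The majorant [psi] replaces the integral of |f'| along the segment. Linear [psi] gives Lipschitz
    bounds; a power-type [psi] is needed where the derivative blows up at the circle. *)
Lemma segment_increment_le (f df : C -> C) (z k : C) (psi dpsi : R -> R) :
  (forall t, 0 <= t <= 1 -> has_cderiv f (z + RtoC t * k)%C (df (z + RtoC t * k)%C)) ->
  (forall t, 0 <= t <= 1 -> is_derive psi t (dpsi t)) ->
  (forall t, 0 <= t <= 1 -> Cmod (df (z + RtoC t * k)%C) * Cmod k <= dpsi t) ->
  Cmod (f (z + k) - f z)%C <= psi 1 - psi 0.
Proof.
intros Hf Hpsi Hle.
pose proof (path_increment_le (fun t => f (z + RtoC t * k)%C)
  (fun t => df (z + RtoC t * k)%C * k)%C psi dpsi 0 1) as H. simpl in H.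
replace (z + RtoC 1 * k)%C with (z + k)%C in H by ring.
replace (z + RtoC 0 * k)%C with z in H by ring.
apply H; auto. lra.
- intros t Ht. apply (is_path_derive_comp f (fun s => z + RtoC s * k)%C). auto. apply is_path_derive_line.
- intros t Ht. rewrite Cmod_mult. auto.
Qed.

(** * Goursat's theorem for rectangles *)

Definition path_continuous (p : R -> C) (t : R) : Prop :=
  continuous (fun s => fst (p s)) t /\ continuous (fun s => snd (p s)) t.

Lemma is_path_derive_path_continuous (p : R -> C) (t : R) (v : C) :
  is_path_derive p t v -> path_continuous p t.
Proof.
intros [H1 H2]; split.
- apply (ex_derive_continuous (fun s => fst (p s))). now eexists; apply H1.
- apply (ex_derive_continuous (fun s => snd (p s))). now eexists; apply H2.
Qed.

Lemma path_continuous_minus (p q : R -> C) (t : R) :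
  path_continuous p t -> path_continuous q t -> path_continuous (fun s => p s - q s)%C t.
Proof.
intros [H1 H2] [K1 K2]; split.
- exact (continuous_minus (V:=R_NormedModule) _ _ t H1 K1).
- exact (continuous_minus (V:=R_NormedModule) _ _ t H2 K2).
Qed.

Definition RIntC (p : R -> C) (a b : R) : C :=
  (RInt (fun t => fst (p t)) a b, RInt (fun t => snd (p t)) a b).

Lemma path_continuous_ex_RInt (p : R -> C) (a b : R) :
  (forall t, Rmin a b <= t <= Rmax a b -> path_continuous p t) ->
  ex_RInt (fun t => fst (p t)) a b /\ ex_RInt (fun t => snd (p t)) a b.
Proof.
intros H. split; apply (ex_RInt_continuous (V:=R_CompleteNormedModule));
  intros t Ht; now apply H.
Qed.

Lemma ordered_between (P : R -> Prop) (a b : R) : a <= b ->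
  (forall t, a <= t <= b -> P t) -> forall t, Rmin a b <= t <= Rmax a b -> P t.
Proof. intros Hab H t. rewrite Rmin_left, Rmax_right; auto. Qed.

Lemma RIntC_swap (p : R -> C) (a b : R) :
  (forall t, Rmin a b <= t <= Rmax a b -> path_continuous p t) ->
  RIntC p b a = (- RIntC p a b)%C.
Proof.
intros H. destruct (path_continuous_ex_RInt p a b H) as [A1 A2].
unfold RIntC. apply injective_projections; simpl; symmetry.
- exact (opp_RInt_swap (V:=R_CompleteNormedModule) _ _ _ A1).
- exact (opp_RInt_swap (V:=R_CompleteNormedModule) _ _ _ A2).
Qed.

Lemma RIntC_const (k : C) (a b : R) : RIntC (fun _ => k) a b = (k * RtoC (b - a))%C.
Proof.
unfold RIntC. rewrite !RInt_const. unfold scal; simpl; unfold mult; simpl.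
apply injective_projections; simpl; ring.
Qed.

Lemma RIntC_ext (p q : R -> C) (a b : R) : a <= b ->
  (forall t, a <= t <= b -> p t = q t) -> RIntC p a b = RIntC q a b.
Proof.
intros Hab H. unfold RIntC. f_equal; apply RInt_ext;
  rewrite Rmin_left, Rmax_right by auto; intros t Ht; rewrite H; auto; lra.
Qed.

Lemma RIntC_Chasles (p : R -> C) (a b c : R) :
  (forall t, Rmin a b <= t <= Rmax a b -> path_continuous p t) ->
  (forall t, Rmin b c <= t <= Rmax b c -> path_continuous p t) ->
  (RIntC p a b + RIntC p b c)%C = RIntC p a c.
Proof.
intros H1 H2.
destruct (path_continuous_ex_RInt p a b H1) as [A1 A2].
destruct (path_continuous_ex_RInt p b c H2) as [B1 B2].
unfold RIntC, Cplus. simpl. f_equal.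
- exact (RInt_Chasles _ a b c A1 B1).
- exact (RInt_Chasles _ a b c A2 B2).
Qed.

Lemma RIntC_minus (p q : R -> C) (a b : R) :
  (forall t, Rmin a b <= t <= Rmax a b -> path_continuous p t) ->
  (forall t, Rmin a b <= t <= Rmax a b -> path_continuous q t) ->
  RIntC (fun t => p t - q t)%C a b = (RIntC p a b - RIntC q a b)%C.
Proof.
intros Hp Hq.
destruct (path_continuous_ex_RInt p a b Hp) as [A1 A2].
destruct (path_continuous_ex_RInt q a b Hq) as [B1 B2].
unfold RIntC. apply injective_projections; simpl.
- exact (RInt_minus (V:=R_CompleteNormedModule) _ _ a b A1 B1).
- exact (RInt_minus (V:=R_CompleteNormedModule) _ _ a b A2 B2).
Qed.

(** The argument of [path_increment_le] again: bound the inner product of the integral with every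
    direction [u], then take the integral itself as [u]. *)
Lemma RIntC_bound (p : R -> C) (a b M : R) : a <= b ->
  (forall t, a <= t <= b -> path_continuous p t) ->
  (forall t, a <= t <= b -> Cmod (p t) <= M) ->
  Cmod (RIntC p a b) <= M * (b - a).
Proof.
intros Hab Hp HM.
destruct (path_continuous_ex_RInt p a b (ordered_between _ a b Hab Hp)) as [A1 A2].
assert (K : forall u : C, fst u * fst (RIntC p a b) + snd u * snd (RIntC p a b)
   <= Cmod u * (M * (b - a))).
{ intros u. unfold RIntC. simpl.
  pose proof (ex_RInt_scal (V:=R_NormedModule) _ a b (fst u) A1) as S1.
  pose proof (ex_RInt_scal (V:=R_NormedModule) _ a b (snd u) A2) as S2.
  assert (E : RInt (fun t => fst u * fst (p t) + snd u * snd (p t)) a b =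
    fst u * RInt (fun t => fst (p t)) a b + snd u * RInt (fun t => snd (p t)) a b).
  { etransitivity. exact (RInt_plus (V:=R_CompleteNormedModule) _ _ a b S1 S2).
    exact (f_equal2 Rplus (RInt_scal (V:=R_CompleteNormedModule) _ a b (fst u) A1)
      (RInt_scal (V:=R_CompleteNormedModule) _ a b (snd u) A2)). }
  rewrite <- E.
  replace (Cmod u * (M * (b - a))) with (RInt (fun _ => Cmod u * M) a b)
    by (rewrite RInt_const; unfold scal; simpl; unfold mult; simpl; ring).
  apply RInt_le; auto.
  - apply (ex_RInt_plus (V:=R_NormedModule)); auto.
  - apply ex_RInt_const.
  - intros t Ht. eapply Rle_trans. apply (inner_le u (p t)).
    apply Rmult_le_compat_l. apply Cmod_ge_0. apply HM. lra. }
assert (M0 : 0 <= M * (b - a)).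
{ apply Rmult_le_pos; [|lra]. eapply Rle_trans; [apply Cmod_ge_0|]. apply (HM a). lra. }
destruct (Req_dec (Cmod (RIntC p a b)) 0) as [E|E].
- rewrite E. auto.
- specialize (K (RIntC p a b)). rewrite <- Cmod_sq in K.
  apply Rmult_le_reg_l in K; auto. pose proof (Cmod_ge_0 (RIntC p a b)). lra.
Qed.

Lemma RIntC_is_path_derive (p v : R -> C) (a b : R) : a <= b ->
  (forall t, a <= t <= b -> is_path_derive p t (v t)) ->
  (forall t, a <= t <= b -> path_continuous v t) ->
  RIntC v a b = (p b - p a)%C.
Proof.
intros Hab Hp Hv. unfold RIntC. apply injective_projections; simpl; apply is_RInt_unique.
- apply (is_RInt_derive (V:=R_CompleteNormedModule) (fun s => fst (p s)));
  rewrite Rmin_left, Rmax_right by auto; intros; [apply Hp | apply Hv]; auto.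
- apply (is_RInt_derive (V:=R_CompleteNormedModule) (fun s => snd (p s)));
  rewrite Rmin_left, Rmax_right by auto; intros; [apply Hp | apply Hv]; auto.
Qed.

(** The factor [Ci] in [vside] is dz = i dt on a vertical line; [rect_int] is then the contour
    integral, counterclockwise when [a <= b] and [c <= d]. *)
Definition hside (F : C -> C) (y a b : R) : C := RIntC (fun t => F (t, y)) a b.
Definition vside (F : C -> C) (x c d : R) : C := RIntC (fun t => Ci * F (x, t))%C c d.
Definition rect_int (F : C -> C) (a b c d : R) : C :=
  (hside F c a b + vside F b c d - hside F d a b - vside F a c d)%C.

Definition holo_rect (F : C -> C) (a b c d : R) : Prop :=
  forall x y, a <= x <= b -> c <= y <= d -> exists l, has_cderiv F (x, y) l.

Lemma is_path_derive_hline (y t : R) : is_path_derive (fun s => (s, y)) t (RtoC 1).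
Proof. split; simpl; auto_derive; auto. Qed.

Lemma is_path_derive_vline (x t : R) : is_path_derive (fun s => (x, s)) t Ci.
Proof. split; simpl; auto_derive; auto. Qed.

Lemma has_cderiv_scal (c : C) (F : C -> C) (z l : C) :
  has_cderiv F z l -> has_cderiv (fun w => c * F w)%C z (c * l)%C.
Proof.
intros H. replace (c * l)%C with (0 * F z + c * l)%C by ring.
apply (has_cderiv_mul (fun _ => c) F); auto. apply has_cderiv_const.
Qed.

Lemma path_continuous_h (F : C -> C) (x y : R) (l : C) :
  has_cderiv F (x, y) l -> path_continuous (fun t => F (t, y)) x.
Proof.
intros H. eapply is_path_derive_path_continuous.
apply (is_path_derive_comp F (fun t => (t, y))); eauto. apply is_path_derive_hline.
Qed.

Lemma path_continuous_v (F : C -> C) (x y : R) (l : C) :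
  has_cderiv F (x, y) l -> path_continuous (fun t => Ci * F (x, t))%C y.
Proof.
intros H. eapply is_path_derive_path_continuous.
apply (is_path_derive_comp (fun w => Ci * F w)%C (fun t => (x, t))).
apply has_cderiv_scal; eauto. apply is_path_derive_vline.
Qed.

Lemma hside_primitive (F G : C -> C) (y a b : R) : a <= b ->
  (forall x, a <= x <= b -> exists l, has_cderiv F (x, y) l) ->
  (forall x, a <= x <= b -> has_cderiv G (x, y) (F (x, y))) ->
  hside F y a b = (G (b, y) - G (a, y))%C.
Proof.
intros Hab HF HG. apply (RIntC_is_path_derive (fun t => G (t, y))); auto.
- intros t Ht. replace (F (t, y)) with (F (t, y) * 1)%C by ring.
  apply (is_path_derive_comp G (fun s => (s, y))); auto. apply is_path_derive_hline.
- intros t Ht. destruct (HF t Ht) as [l Hl]. eapply path_continuous_h; eauto.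
Qed.

Lemma vside_primitive (F G : C -> C) (x c d : R) : c <= d ->
  (forall y, c <= y <= d -> exists l, has_cderiv F (x, y) l) ->
  (forall y, c <= y <= d -> has_cderiv G (x, y) (F (x, y))) ->
  vside F x c d = (G (x, d) - G (x, c))%C.
Proof.
intros Hab HF HG. apply (RIntC_is_path_derive (fun t => G (x, t))); auto.
- intros t Ht. replace (Ci * F (x, t))%C with (F (x, t) * Ci)%C by ring.
  apply (is_path_derive_comp G (fun s => (x, s))); auto. apply is_path_derive_vline.
- intros t Ht. destruct (HF t Ht) as [l Hl]. eapply path_continuous_v; eauto.
Qed.

(** Each side contributes the difference of [G] at its end points, and the corner values cancel. *)
Lemma rect_int_primitive (F G : C -> C) (a b c d : R) : a <= b -> c <= d ->
  holo_rect F a b c d ->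
  (forall x y, a <= x <= b -> c <= y <= d -> has_cderiv G (x, y) (F (x, y))) ->
  rect_int F a b c d = RtoC 0.
Proof.
intros Hab Hcd HF HG. unfold rect_int.
rewrite (hside_primitive F G c), (hside_primitive F G d),
  (vside_primitive F G a), (vside_primitive F G b); auto; try ring;
  intros; (apply HF || apply HG); lra.
Qed.

Lemma rect_int_minus (F G : C -> C) (a b c d : R) : a <= b -> c <= d ->
  holo_rect F a b c d -> holo_rect G a b c d ->
  rect_int (fun z => F z - G z)%C a b c d = (rect_int F a b c d - rect_int G a b c d)%C.
Proof.
intros Hab Hcd HF HG.
assert (Hh : forall H y t, holo_rect H a b c d -> a <= t <= b -> c <= y <= d ->
  path_continuous (fun t => H (t, y)) t).
{ intros H y t HH Ht Hy. destruct (HH t y) as [l Hl]; auto. eapply path_continuous_h; eauto. }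
assert (Hv : forall H x t, holo_rect H a b c d -> a <= x <= b -> c <= t <= d ->
  path_continuous (fun t => Ci * H (x, t))%C t).
{ intros H x t HH Hx Ht. destruct (HH x t) as [l Hl]; auto. eapply path_continuous_v; eauto. }
assert (Eh : forall y, c <= y <= d ->
  hside (fun z => F z - G z)%C y a b = (hside F y a b - hside G y a b)%C).
{ intros y Hy. apply (RIntC_minus (fun t => F (t, y)) (fun t => G (t, y)));
  apply ordered_between; auto. }
assert (Ev : forall x, a <= x <= b ->
  vside (fun z => F z - G z)%C x c d = (vside F x c d - vside G x c d)%C).
{ intros x Hx. unfold vside. rewrite <- (RIntC_minus (fun t => Ci * F (x, t))%C (fun t => Ci * G (x, t))%C);
    try (apply ordered_between; auto).
  apply RIntC_ext; auto. intros; ring. }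
unfold rect_int. rewrite !Eh, !Ev by lra. ring.
Qed.

Lemma rect_int_bound (F : C -> C) (a b c d M : R) : a <= b -> c <= d ->
  holo_rect F a b c d ->
  (forall x y, a <= x <= b -> c <= y <= d -> Cmod (F (x, y)) <= M) ->
  Cmod (rect_int F a b c d) <= 2 * M * ((b - a) + (d - c)).
Proof.
intros Hab Hcd HF HM.
assert (Bh : forall y, c <= y <= d -> Cmod (hside F y a b) <= M * (b - a)).
{ intros y Hy. apply RIntC_bound; auto. intros t Ht.
  destruct (HF t y) as [l Hl]; auto. eapply path_continuous_h; eauto. }
assert (Bv : forall x, a <= x <= b -> Cmod (vside F x c d) <= M * (d - c)).
{ intros x Hx. apply RIntC_bound; auto.
  - intros t Ht. destruct (HF x t) as [l Hl]; auto. eapply path_continuous_v; eauto.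
  - intros t Ht. rewrite Cmod_mult, Cmod_Ci, Rmult_1_l. auto. }
unfold rect_int.
pose proof (Cmod_triangle (hside F c a b + vside F b c d - hside F d a b)%C (- vside F a c d)%C) as T1.
pose proof (Cmod_triangle (hside F c a b + vside F b c d)%C (- hside F d a b)%C) as T2.
pose proof (Cmod_triangle (hside F c a b) (vside F b c d)) as T3.
rewrite Cmod_opp in T1, T2.
change (Cmod ((hside F c a b + vside F b c d - hside F d a b) + - vside F a c d)%C
  <= 2 * M * (b - a + (d - c))).
change (hside F c a b + vside F b c d + - hside F d a b)%C with
  (hside F c a b + vside F b c d - hside F d a b)%C in T2.
pose proof (Bh c ltac:(lra)). pose proof (Bh d ltac:(lra)).
pose proof (Bv a ltac:(lra)). pose proof (Bv b ltac:(lra)). lra.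
Qed.

Lemma rect_int_split_x (F : C -> C) (a m b c d : R) : a <= m -> m <= b -> c <= d ->
  holo_rect F a b c d ->
  rect_int F a b c d = (rect_int F a m c d + rect_int F m b c d)%C.
Proof.
intros Ham Hmb Hcd HF. unfold rect_int.
assert (E : forall y, c <= y <= d -> hside F y a b = (hside F y a m + hside F y m b)%C).
{ intros y Hy. symmetry. apply RIntC_Chasles; (apply ordered_between; [lra|]); intros t Ht;
  destruct (HF t y) as [l Hl]; auto; try lra; eapply path_continuous_h; eauto. }
rewrite !E by lra. ring.
Qed.

Lemma rect_int_split_y (F : C -> C) (a b c m d : R) : a <= b -> c <= m -> m <= d ->
  holo_rect F a b c d ->
  rect_int F a b c d = (rect_int F a b c m + rect_int F a b m d)%C.
Proof.
intros Hab Hcm Hmd HF. unfold rect_int.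
assert (E : forall x, a <= x <= b -> vside F x c d = (vside F x c m + vside F x m d)%C).
{ intros x Hx. symmetry. apply RIntC_Chasles; (apply ordered_between; [lra|]); intros t Ht;
  destruct (HF x t) as [l Hl]; auto; try lra; eapply path_continuous_v; eauto. }
rewrite !E by lra. ring.
Qed.

Lemma holo_rect_sub (F : C -> C) (a b c d a' b' c' d' : R) :
  a <= a' -> b' <= b -> c <= c' -> d' <= d ->
  holo_rect F a b c d -> holo_rect F a' b' c' d'.
Proof. intros ? ? ? ? H x y Hx Hy. apply H; lra. Qed.

(** The four quarters add up to the whole, so one of them carries at least a quarter of the modulus.
    Rectangles are given by a corner and side lengths because the lengths are the same for all
    four. *)
Lemma rect_int_quarter (F : C -> C) (a c w h : R) : 0 <= w -> 0 <= h ->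
  holo_rect F a (a + 2 * w) c (c + 2 * h) ->
  exists a' c', (a' = a \/ a' = a + w) /\ (c' = c \/ c' = c + h) /\
    Cmod (rect_int F a (a + 2 * w) c (c + 2 * h)) <=
    4 * Cmod (rect_int F a' (a' + w) c' (c' + h)).
Proof.
intros Hw Hh HF.
rewrite (rect_int_split_x F a (a + w)) by (auto; lra).
rewrite (rect_int_split_y F a _ c (c + h)), (rect_int_split_y F (a + w) _ c (c + h));
  try lra; try (eapply holo_rect_sub; [..|apply HF]; lra).
replace (a + 2 * w) with (a + w + w) by ring. replace (c + 2 * h) with (c + h + h) by ring.
match goal with |- context [Cmod (?x + ?y + (?z + ?t))%C] =>
  pose proof (Cmod_triangle (x + y)%C (z + t)%C);
  pose proof (Cmod_triangle x y); pose proof (Cmod_triangle z t);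
  destruct (Rle_dec (Cmod (x + y + (z + t))%C) (4 * Cmod x)) as [K1|K1];
  [|destruct (Rle_dec (Cmod (x + y + (z + t))%C) (4 * Cmod y)) as [K2|K2];
  [|destruct (Rle_dec (Cmod (x + y + (z + t))%C) (4 * Cmod z)) as [K3|K3]]] end.
- exists a, c; auto.
- exists a, (c + h); auto.
- exists (a + w), c; auto.
- exists (a + w), (c + h); repeat split; auto. lra.
Qed.

(* On the small rectangle [F] is an affine function, which has a primitive, up to an error [eps * diam]. *)
Lemma rect_int_local (F : C -> C) (x0 y0 : R) (l : C) (eps : R) :
  has_cderiv F (x0, y0) l -> 0 < eps ->
  exists delta, 0 < delta /\ forall a c w h, 0 <= w -> 0 <= h -> w + h < delta ->
    a <= x0 <= a + w -> c <= y0 <= c + h ->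
    holo_rect F a (a + w) c (c + h) ->
    Cmod (rect_int F a (a + w) c (c + h)) <= eps * ((w + h) * (w + h)).
Proof.
intros Hl Heps. destruct (proj1 (has_cderivP F _ l) Hl (eps / 2)) as [d [Hd K]]. lra.
exists d. split; auto. intros a c w h Hw Hh Hwh Hx Hy HF.
set (p := (x0, y0) : C).
set (G := (fun z => (F p - l * p) * z + l * / 2 * (z * z))%C).
(* [A] is the first-order Taylor polynomial of [F] at [p], and [G] is its primitive. *)
set (A := (fun z => F p - l * p - (- l) * z)%C).
assert (DA : forall z, has_cderiv A z (0 - - l * 1)%C).
{ intros z. apply (has_cderiv_sub (fun _ => F p - l * p)%C (fun w => - l * w)%C).
  apply has_cderiv_const. apply (has_cderiv_scal (- l) (fun w => w)). apply has_cderiv_id. }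
assert (DG : forall z, has_cderiv G z (A z)).
{ intros z.
  replace (A z) with ((F p - l * p) * 1 - (- l * / 2) * (1 * z + z * 1))%C.
  2:{ unfold A. field. }
  assert (D : has_cderiv (fun z => (F p - l * p) * z - (- l * / 2) * (z * z))%C z
     ((F p - l * p) * 1 - (- l * / 2) * (1 * z + z * 1))%C).
  { apply (has_cderiv_sub (fun z => (F p - l * p) * z)%C (fun z => (- l * / 2) * (z * z))%C).
    apply (has_cderiv_scal (F p - l * p)%C (fun w => w)). apply has_cderiv_id.
    apply (has_cderiv_scal _ (fun z => z * z)%C).
    apply (has_cderiv_mul (fun w => w) (fun w => w)); apply has_cderiv_id. }
  eapply has_cderiv_ext_loc with (r := 1); [lra| |apply D].
  intros; unfold G; ring. }
assert (HA : holo_rect A a (a + w) c (c + h)) by (intros x y _ _; eexists; apply DA).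
assert (E : rect_int F a (a + w) c (c + h) = rect_int (fun z => F z - A z)%C a (a + w) c (c + h)).
{ rewrite rect_int_minus by (auto; lra).
  rewrite (rect_int_primitive A G) by (auto; lra). ring. }
rewrite E.
replace (eps * ((w + h) * (w + h))) with (2 * (eps / 2 * (w + h)) * ((a + w - a) + (c + h - c))) by field.
apply rect_int_bound; try lra.
- intros x y Hx' Hy'. destruct (HF x y Hx' Hy') as [m Hm]. eexists.
  apply (has_cderiv_sub F A); eauto.
- intros x y Hx' Hy'. set (k := ((x, y) - p)%C).
  assert (Hk : Cmod k <= w + h).
  { eapply Rle_trans; [apply Cmod_le_sum|]. simpl.
    apply Rplus_le_compat; apply Rabs_le; lra. }
  specialize (K k ltac:(lra)). fold p in K.
  replace (p + k)%C with ((x, y) : C) in K by (apply injective_projections; simpl; ring).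
  replace (F (x, y) - A (x, y))%C with (F (x, y) - F p - l * k)%C by (unfold A, k; ring).
  eapply Rle_trans; [apply K|]. apply Rmult_le_compat_l; lra.
Qed.

(** Repeated quartering closes in on a point. There the n-th integral is at most eps (D / 2^n)^2,
    with [D] half the perimeter, and the factor 4^n lost in n steps cancels exactly. *)
Lemma goursat (F : C -> C) (a b c d : R) : a <= b -> c <= d ->
  holo_rect F a b c d -> rect_int F a b c d = RtoC 0.
Proof.
intros Hab Hcd HF.
set (w := fun n => (b - a) / 2 ^ n). set (h := fun n => (d - c) / 2 ^ n).
assert (P2 : forall n, 0 < 2 ^ n) by (intros; apply pow_lt; lra).
assert (Wp : forall n, 0 <= w n) by (intros; apply Rdiv_le_0_compat; [lra|auto]).
assert (Hp : forall n, 0 <= h n) by (intros; apply Rdiv_le_0_compat; [lra|auto]).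
assert (WS : forall n, w n = 2 * w (S n)).
{ intros. unfold w. simpl. pose proof (P2 n). field. lra. }
assert (HS : forall n, h n = 2 * h (S n)).
{ intros. unfold h. simpl. pose proof (P2 n). field. lra. }
(* [s] and [q] are lower left corners of the rectangles at stages [n] and [S n]; the sequence [st]
   chooses such a [q] at every stage. *)
set (next := fun (n : nat) (s q : R * R) =>
  (fst q = fst s \/ fst q = fst s + w (S n)) /\ (snd q = snd s \/ snd q = snd s + h (S n)) /\
  Cmod (rect_int F (fst s) (fst s + w n) (snd s) (snd s + h n)) <=
  4 * Cmod (rect_int F (fst q) (fst q + w (S n)) (snd q) (snd q + h (S n)))).
set (st := fix st n := match n with
  | O => (a, c) | S k => epsilon (inhabits (a, c)) (next k (st k)) end).
assert (Inv : forall n, a <= fst (st n) /\ fst (st n) + w n <= b /\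
   c <= snd (st n) /\ snd (st n) + h n <= d /\ next n (st n) (st (S n))).
{ assert (N : forall n, a <= fst (st n) /\ fst (st n) + w n <= b /\
   c <= snd (st n) /\ snd (st n) + h n <= d -> next n (st n) (st (S n))).
  { intros n Hn. apply (epsilon_spec (inhabits (a, c)) (next n (st n))).
    destruct (rect_int_quarter F (fst (st n)) (snd (st n)) (w (S n)) (h (S n)))
      as [a' [c' Q]]; auto.
    - rewrite <- WS, <- HS. eapply holo_rect_sub; [..|apply HF]; lra.
    - exists (a', c'). unfold next. rewrite (WS n), (HS n). exact Q. }
  induction n as [|n IH].
  - assert (I0 : a <= fst (st O) /\ fst (st O) + w O <= b /\
      c <= snd (st O) /\ snd (st O) + h O <= d).
    { unfold st, w, h; simpl. lra. }
    split; [apply I0|]. split; [apply I0|]. split; [apply I0|]. split; [apply I0|]. now apply N.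
  - destruct IH as (I1 & I2 & I3 & I4 & I5 & I6 & _).
    pose proof (WS n). pose proof (HS n). pose proof (Wp (S n)). pose proof (Hp (S n)).
    assert (I : a <= fst (st (S n)) /\ fst (st (S n)) + w (S n) <= b /\
      c <= snd (st (S n)) /\ snd (st (S n)) + h (S n) <= d) by lra.
    pose proof (N (S n) I). tauto. }
assert (J : forall n, Cmod (rect_int F a b c d) <= 4 ^ n *
  Cmod (rect_int F (fst (st n)) (fst (st n) + w n) (snd (st n)) (snd (st n) + h n))).
{ induction n as [|n IH].
  - simpl. unfold w, h. simpl. replace (a + (b - a) / 1) with b by field.
    replace (c + (d - c) / 1) with d by field. lra.
  - destruct (Inv n) as (_ & _ & _ & _ & _ & _ & I).
    eapply Rle_trans; [apply IH|]. rewrite <- tech_pow_Rmult, (Rmult_comm 4), Rmult_assoc.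
    apply Rmult_le_compat_l; auto. left; apply pow_lt; lra. }
(* Nested intervals, in each coordinate: the common point is the supremum of the left end points. *)
assert (Lim : forall (s sz : nat -> R), (forall n, s n <= s (S n) /\ s (S n) + sz (S n) <= s n + sz n) ->
   (forall n, 0 <= sz n) -> exists x, forall n, s n <= x <= s n + sz n).
{ intros s sz M Z.
  assert (M1 : forall n k, s n <= s (n + k)%nat /\ s (n + k)%nat + sz (n + k)%nat <= s n + sz n).
  { intros n k. induction k as [|k IH]. rewrite Nat.add_0_r; lra.
    rewrite Nat.add_succ_r. specialize (M (n + k)%nat). lra. }
  assert (M2 : forall n k, s k <= s n + sz n).
  { intros n k. destruct (Nat.le_ge_cases n k) as [L|L].
    - replace k with (n + (k - n))%nat by lia. destruct (M1 n (k - n)%nat). pose proof (Z (n + (k - n))%nat). lra.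
    - replace n with (k + (n - k))%nat by lia. destruct (M1 k (n - k)%nat). pose proof (Z (k + (n - k))%nat). lra. }
  destruct (completeness (fun y => exists n, y = s n)) as [x [U L]].
  - exists (s O + sz O). intros y [n ->]. apply M2.
  - exists (s O), O. auto.
  - exists x. intros n. split. apply U; eauto. apply L. intros y [k ->]. apply M2. }
destruct (Lim (fun n => fst (st n)) w) as [x0 Hx0]; auto.
{ intros n. destruct (Inv n) as (_ & _ & _ & _ & I & _). pose proof (WS n). pose proof (Wp (S n)). lra. }
destruct (Lim (fun n => snd (st n)) h) as [y0 Hy0]; auto.
{ intros n. destruct (Inv n) as (_ & _ & _ & _ & _ & I & _). pose proof (HS n). pose proof (Hp (S n)). lra. }
destruct (HF x0 y0) as [l Hl].
{ specialize (Hx0 O). destruct (Inv O) as (I1 & I2 & _). lra. }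
{ specialize (Hy0 O). destruct (Inv O) as (_ & _ & I1 & I2 & _). lra. }
set (D := (b - a) + (d - c)).
assert (B : forall eps, 0 < eps -> Cmod (rect_int F a b c d) <= eps * (D * D)).
{ intros eps Heps. destruct (rect_int_local F x0 y0 l eps Hl Heps) as [del [Hdel K]].
  destruct (Pow_x_infinity 2 ltac:(rewrite Rabs_right; lra) (D / del + 1)) as [n Hn].
  specialize (Hn n (Nat.le_refl _)). rewrite Rabs_right in Hn by (apply Rle_ge; left; auto).
  pose proof (P2 n) as Pn.
  assert (Small : w n + h n < del).
  { replace (w n + h n) with (D / 2 ^ n) by (unfold w, h, D; field; lra).
    apply Rlt_div_l; auto.
    assert (E : D = del * (D / del)) by (field; lra).
    assert (del * (D / del) < del * 2 ^ n) by (apply Rmult_lt_compat_l; lra). lra. }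
  eapply Rle_trans; [apply (J n)|].
  destruct (Inv n) as (I1 & I2 & I3 & I4 & _).
  eapply Rle_trans.
  { apply Rmult_le_compat_l. left; apply pow_lt; lra.
    apply K; auto. eapply holo_rect_sub; [..|apply HF]; lra. }
  right. replace (4 ^ n) with (2 ^ n * 2 ^ n) by (rewrite <- Rpow_mult_distr; f_equal; ring).
  unfold w, h, D. field. lra. }
apply Cmod_eq_0. apply Rle_antisym; [|apply Cmod_ge_0].
apply le_epsilon. intros e He. rewrite Rplus_0_l.
assert (0 <= D * D) by (apply Rle_0_sqr).
(* The added 1 covers a rectangle degenerated to a point. *)
specialize (B (e / (D * D + 1)) ltac:(apply Rdiv_lt_0_compat; lra)).
eapply Rle_trans; [apply B|]. unfold Rdiv. rewrite Rmult_assoc.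
rewrite <- (Rmult_1_r e) at 2. apply Rmult_le_compat_l. lra.
apply (Rmult_le_reg_l (D * D + 1)). lra. rewrite <- Rmult_assoc, Rinv_r, Rmult_1_l; lra.
Qed.

(** The primitive below uses rectangles with sides from [x] to [x + s] and from 0 to [y], where [s]
    and [y] have any sign; reversing a range only changes signs of sides. *)
Lemma goursat_unordered (F : C -> C) (a b c d : R) :
  (forall x y, Rmin a b <= x <= Rmax a b -> Rmin c d <= y <= Rmax c d ->
     exists l, has_cderiv F (x, y) l) ->
  rect_int F a b c d = RtoC 0.
Proof.
intros HF.
assert (Bc : forall u v, Rmin u v <= u <= Rmax u v /\ Rmin u v <= v <= Rmax u v).
{ intros u v. unfold Rmin, Rmax. destruct Rle_dec; lra. }
assert (Sx : forall y, Rmin c d <= y <= Rmax c d -> hside F y b a = (- hside F y a b)%C).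
{ intros y Hy. apply RIntC_swap. intros t Ht. destruct (HF t y) as [l Hl]; auto.
  eapply path_continuous_h; eauto. }
assert (Sy : forall x, Rmin a b <= x <= Rmax a b -> vside F x d c = (- vside F x c d)%C).
{ intros x Hx. apply RIntC_swap. intros t Ht. destruct (HF x t) as [l Hl]; auto.
  eapply path_continuous_v; eauto. }
assert (G : rect_int F (Rmin a b) (Rmax a b) (Rmin c d) (Rmax c d) = RtoC 0).
{ apply goursat; auto; unfold Rmin, Rmax; destruct Rle_dec; lra. }
pose proof (Sx c (proj1 (Bc c d))) as S1. pose proof (Sx d (proj2 (Bc c d))) as S2.
pose proof (Sy a (proj1 (Bc a b))) as S3. pose proof (Sy b (proj2 (Bc a b))) as S4.
clear - G S1 S2 S3 S4. unfold rect_int, Rmin, Rmax in *.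
destruct (Rle_dec a b), (Rle_dec c d); auto.
- rewrite S3, S4 in G. replace (RtoC 0) with (- RtoC 0)%C by ring. rewrite <- G. ring.
- rewrite S1, S2 in G. replace (RtoC 0) with (- RtoC 0)%C by ring. rewrite <- G. ring.
- rewrite S1, S2, S3, S4 in G. rewrite <- G. ring.
Qed.

(** Serves twice: on short ranges it differentiates a primitive, on a full period it gives the limit
    of circular means at the centre. *)
Lemma RIntC_near_const (p : R -> C) (a b eps : R) (k : C) :
  (forall t, Rmin a b <= t <= Rmax a b -> path_continuous p t) ->
  (forall t, Rmin a b <= t <= Rmax a b -> Cmod (p t - k)%C <= eps) ->
  Cmod (RIntC p a b - k * RtoC (b - a))%C <= eps * Rabs (b - a).
Proof.
assert (W : forall a b, a <= b -> (forall t, a <= t <= b -> path_continuous p t) ->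
  (forall t, a <= t <= b -> Cmod (p t - k)%C <= eps) ->
  Cmod (RIntC p a b - k * RtoC (b - a))%C <= eps * Rabs (b - a)).
{ intros a' b' Hab Hp He. rewrite Rabs_right by lra.
  assert (Pk : forall t, path_continuous (fun _ => k) t)
    by (intros t; split; apply continuous_const).
  rewrite <- RIntC_const, <- RIntC_minus by (apply ordered_between; auto).
  apply RIntC_bound; auto. intros; apply path_continuous_minus; auto. }
intros Hp He. destruct (Rle_dec a b) as [L|L].
- rewrite Rmin_left, Rmax_right in Hp, He by auto. auto.
- rewrite Rmin_right, Rmax_left in Hp, He by lra.
  rewrite RIntC_swap, Rabs_minus_sym by (rewrite Rmin_left, Rmax_right; auto; lra).
  replace (- RIntC p b a - k * RtoC (b - a))%C with (- (RIntC p b a - k * RtoC (a - b)))%C.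
  rewrite Cmod_opp. apply W; auto; lra.
  rewrite !RtoC_minus. ring.
Qed.

(** * Primitives, circular means and the Cauchy estimate *)

Lemma inD_Cmod (z : C) : inD z <-> Cmod z < 1.
Proof. unfold inD. now rewrite Cmod_Complex. Qed.

(** Keeps every point of the paths and rectangles between 0, [z] and [z + k] inside the disc as soon
    as |z| + 2 |k| < 1. *)
Lemma Cmod_box_le (z : C) (x y e : R) : 0 <= e ->
  Rabs x <= Rabs (fst z) + e -> Rabs y <= Rabs (snd z) + e ->
  Cmod (x, y) <= Cmod z + 2 * e.
Proof.
intros He Hx Hy.
assert (M : Cmod (x, y) <= Cmod (Rabs (fst z) + e, Rabs (snd z) + e)).
{ unfold Cmod. apply sqrt_le_1_alt. cbn [fst snd].
  rewrite <- (pow2_abs x), <- (pow2_abs y).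
  apply Rplus_le_compat; apply pow_incr; split; auto; apply Rabs_pos. }
pose proof (Cmod_triangle (Rabs (fst z), Rabs (snd z)) (e, e)) as T.
unfold Cplus in T; simpl in T.
assert (E1 : Cmod (Rabs (fst z), Rabs (snd z)) = Cmod z).
{ unfold Cmod. cbn [fst snd]. now rewrite !pow2_abs. }
pose proof (Cmod_le_sum (e, e)) as T2. simpl in T2. rewrite Rabs_right in T2 by lra.
lra.
Qed.

Lemma between_abs (a b t e : R) : Rabs b <= Rabs a + e -> 0 <= e ->
  Rmin 0 b <= t <= Rmax 0 b \/ Rmin a b <= t <= Rmax a b \/ Rmin 0 a <= t <= Rmax 0 a ->
  Rabs t <= Rabs a + e.
Proof.
unfold Rmin, Rmax, Rabs. intros.
repeat (destruct Rle_dec in *); repeat (destruct Rcase_abs in *); lra.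
Qed.

(** [h] integrates along the real axis and then vertically. Goursat's theorem on the rectangle over
    [x, x + s] of height [y] moves the horizontal displacement from the axis up to the point itself,
    where [u] is nearly constant. *)
Lemma disc_primitive (u : C -> C) : holoD u ->
  exists h, h C0 = C0 /\ forall z, inD z -> has_cderiv h z (u z).
Proof.
intros Hu.
set (h := fun z : C => (hside u 0 0 (fst z) + vside u (fst z) 0 (snd z))%C).
exists h. split.
{ unfold h, hside, vside, RIntC, C0. cbn [fst snd]. rewrite !RInt_point.
  unfold zero; simpl. apply injective_projections; simpl; ring. }
intros z Hz. destruct (Hu z Hz) as [l Hl].
pose proof (proj1 (inD_Cmod z) Hz) as Hz1.
apply has_cderivP. intros eps Heps.
destruct (has_cderiv_cont u z l Hl (eps / 2)) as [d [Hd K]]. lra.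
(* Points of the two short sides are within |s| + |t| <= 2 |k| < d of [z]; the second bound keeps
   the boxes inside the disc. *)
exists (Rmin (d / 2) ((1 - Cmod z) / 2)). split. apply Rmin_glb_lt; lra.
intros k Hk.
pose proof (Rlt_le_trans _ _ _ Hk (Rmin_l _ _)) as Hk1.
pose proof (Rlt_le_trans _ _ _ Hk (Rmin_r _ _)) as Hk2.
destruct z as [x y]. destruct k as [s t].
set (e := Cmod (s, t)) in *.
pose proof (Rabs_fst_le (s, t)) as Hs. pose proof (Rabs_snd_le (s, t)) as Ht.
cbn [fst snd] in Hs, Ht. fold e in Hs, Ht.
assert (He : 0 <= e) by apply Cmod_ge_0.
assert (Hol : forall a b, Rabs a <= Rabs x + e -> Rabs b <= Rabs y + e ->
   exists l, has_cderiv u (a, b) l).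
{ intros a b Ha Hb. apply Hu. apply inD_Cmod.
  pose proof (Cmod_box_le (x, y) a b e He Ha Hb). lra. }
assert (Bx : Rabs (x + s) <= Rabs x + e) by (generalize (Rabs_triang x s); lra).
assert (By : Rabs (y + t) <= Rabs y + e) by (generalize (Rabs_triang y t); lra).
assert (Hx : forall a b, Rabs a <= Rabs x + e -> Rabs b <= Rabs y + e ->
   path_continuous (fun t => u (t, b)) a).
{ intros a b Ha Hb. destruct (Hol a b Ha Hb) as [m Hm]. eapply path_continuous_h; eauto. }
assert (Hy : forall a b, Rabs a <= Rabs x + e -> Rabs b <= Rabs y + e ->
   path_continuous (fun t => Ci * u (a, t))%C b).
{ intros a b Ha Hb. destruct (Hol a b Ha Hb) as [m Hm]. eapply path_continuous_v; eauto. }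
assert (G := goursat_unordered u x (x + s) 0 y).
assert (E1 : (hside u 0 0 x + hside u 0 x (x + s))%C = hside u 0 0 (x + s)).
{ apply RIntC_Chasles; intros a Ha; apply Hx; try (rewrite Rabs_R0; generalize (Rabs_pos y); lra);
  apply between_abs with (b := x + s); auto. }
assert (E2 : (vside u (x + s) 0 y + vside u (x + s) y (y + t))%C = vside u (x + s) 0 (y + t)).
{ apply RIntC_Chasles; intros a Ha; apply Hy; auto; apply between_abs with (b := y + t); auto. }
assert (Cl : forall a b, Cmod ((a, b) - (x, y))%C < d -> Cmod (u (a, b) - u (x, y))%C <= eps / 2).
{ intros a b Hab. left. specialize (K _ Hab).
  replace ((x, y) + ((a, b) - (x, y)))%C with ((a, b) : C) in K; auto.
  apply injective_projections; simpl; ring. }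
assert (Q1 : Cmod (hside u y x (x + s) - u (x, y) * RtoC s)%C <= eps / 2 * e).
{ replace (RtoC s) with (RtoC (x + s - x)) by (f_equal; ring).
  apply Rle_trans with (eps / 2 * Rabs (x + s - x)).
  2:{ apply Rmult_le_compat_l. lra. replace (x + s - x) with s by ring. auto. }
  apply (RIntC_near_const (fun t => u (t, y))).
  - intros a Ha. apply Hx. apply between_abs with (b := x + s); auto. lra.
  - intros a Ha. apply Cl.
    eapply Rle_lt_trans; [apply Cmod_le_sum|]. simpl.
    replace (y + - y) with 0 by ring. rewrite Rabs_R0.
    assert (Rabs (a + - x) <= Rabs s).
    { revert Ha. unfold Rmin, Rmax, Rabs.
      repeat destruct Rle_dec; repeat destruct Rcase_abs; lra. }
    lra. }
assert (Q2 : Cmod (vside u (x + s) y (y + t) - Ci * u (x, y) * RtoC t)%C <= eps / 2 * e).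
{ replace (RtoC t) with (RtoC (y + t - y)) by (f_equal; ring).
  apply Rle_trans with (eps / 2 * Rabs (y + t - y)).
  2:{ apply Rmult_le_compat_l. lra. replace (y + t - y) with t by ring. auto. }
  apply (RIntC_near_const (fun t => Ci * u ((x + s)%R, t))%C).
  - intros a Ha. apply Hy; auto. apply between_abs with (b := y + t); auto.
  - intros a Ha.
    replace (Ci * u ((x + s)%R, a) - Ci * u (x, y))%C with (Ci * (u ((x + s)%R, a) - u (x, y)))%C by ring.
    rewrite Cmod_mult, Cmod_Ci, Rmult_1_l. apply Cl.
    eapply Rle_lt_trans; [apply Cmod_le_sum|]. simpl.
    replace (x + s + - x) with s by ring.
    assert (Rabs (a + - y) <= Rabs t).
    { revert Ha. unfold Rmin, Rmax, Rabs.
      repeat destruct Rle_dec; repeat destruct Rcase_abs; lra. }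
    lra. }
assert (E3 : (h ((x, y) + (s, t)) - h (x, y) - u (x, y) * (s, t))%C =
  ((hside u y x (x + s)%R - u (x, y) * RtoC s) +
   (vside u (x + s)%R y (y + t)%R - Ci * u (x, y) * RtoC t))%C).
{ change (h ((x, y) + (s, t))%C) with (hside u 0 0 (x + s)%R + vside u (x + s)%R 0 (y + t)%R)%C.
  change (h (x, y)) with (hside u 0 0 x + vside u x 0 y)%C.
  rewrite <- E1, <- E2.
  unfold rect_int in G.
  assert (G' : (hside u 0 x (x + s)%R + vside u (x + s)%R 0 y -
    hside u y x (x + s)%R - vside u x 0 y)%C = RtoC 0).
  { apply G. intros a b Ha Hb. apply Hol.
    apply between_abs with (b := x + s); auto. apply between_abs with (b := y + t); auto. }
  replace ((s, t) : C) with (RtoC s + Ci * RtoC t)%C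
    by (apply injective_projections; simpl; ring).
  match goal with |- ?l = ?r => replace l with (r + (hside u 0 x (x + s)%R + vside u (x + s)%R 0 y -
    hside u y x (x + s)%R - vside u x 0 y))%C by ring end.
  rewrite G'. ring. }
rewrite E3. eapply Rle_trans; [apply Cmod_triangle|]. lra.
Qed.

Definition Cexp (z : C) : C := (exp (fst z) * cos (snd z), exp (fst z) * sin (snd z)).

Lemma Cmod_Cexp (z : C) : Cmod (Cexp z) = exp (fst z).
Proof.
unfold Cexp, Cmod. cbn [fst snd].
replace ((exp (fst z) * cos (snd z)) ^ 2 + (exp (fst z) * sin (snd z)) ^ 2)
  with (exp (fst z) * exp (fst z) * (Rsqr (sin (snd z)) + Rsqr (cos (snd z))))
  by (unfold Rsqr; ring).
rewrite sin2_cos2, Rmult_1_r. apply sqrt_square. left. apply exp_pos.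
Qed.

Lemma Cexp_plus (z w : C) : Cexp (z + w)%C = (Cexp z * Cexp w)%C.
Proof.
unfold Cexp, Cplus, Cmult. cbn [fst snd]. rewrite exp_plus, cos_plus, sin_plus.
f_equal; ring.
Qed.

(** Two mean value estimates along s -> exp(s h): the first bounds exp(s h) - 1, which up to the
    factor [h] is the derivative of the remainder in the second. The constant [exp 1] bounds |exp(s
    h)| for |h| <= 1. *)
Lemma Cexp_taylor (h : C) : Cmod h <= 1 ->
  Cmod (Cexp h - 1 - h)%C <= exp 1 * Cmod h * Cmod h.
Proof.
intros Hh. set (p := fun s : R => Cexp (RtoC s * h)%C).
assert (Dp : forall t, is_path_derive p t (p t * h)%C).
{ intros t. unfold p, Cexp. split; simpl; auto_derive; auto; unfold Rminus; ring. }
assert (Bp : forall t, 0 <= t <= 1 -> Cmod (p t) <= exp 1).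
{ intros t Ht. unfold p. rewrite Cmod_Cexp.
  assert (fst (RtoC t * h)%C <= 1).
  { replace (fst (RtoC t * h)%C) with (t * fst h) by (simpl; ring).
    pose proof (Rabs_fst_le h). pose proof (Rle_abs (fst h)). nra. }
  destruct H as [H| ->]; [left; now apply exp_increasing | lra]. }
assert (P0 : p 0 = RtoC 1).
{ unfold p, Cexp. simpl. rewrite !Rmult_0_l, Rminus_0_r, Rplus_0_r.
  now rewrite exp_0, cos_0, sin_0, Rmult_1_l, Rmult_0_r. }
assert (P1 : p 1 = Cexp h).
{ unfold p. f_equal. ring. }
pose proof (Cmod_ge_0 h) as H0. pose proof (exp_pos 1) as He.
assert (L1 : forall t, 0 <= t <= 1 -> Cmod (p t - 1)%C <= exp 1 * Cmod h).
{ intros t Ht. rewrite <- P0.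
  apply Rle_trans with (exp 1 * Cmod h * t - exp 1 * Cmod h * 0).
  2:{ assert (0 <= exp 1 * Cmod h) by (apply Rmult_le_pos; lra). nra. }
  apply (path_increment_le p (fun t => p t * h)%C (fun t => exp 1 * Cmod h * t)
    (fun _ => exp 1 * Cmod h)); auto. lra.
  - intros; auto_derive; auto; ring.
  - intros s Hs. rewrite Cmod_mult. apply Rmult_le_compat_r; auto. apply Bp. lra. }
replace (Cexp h - 1 - h)%C with ((p 1%R - RtoC 1 * h) - (p 0%R - RtoC 0 * h))%C
  by (rewrite P0, P1; ring).
replace (exp 1 * Cmod h * Cmod h) with
  (exp 1 * Cmod h * Cmod h * 1 - exp 1 * Cmod h * Cmod h * 0) by ring.
apply (path_increment_le (fun t => p t - RtoC t * h)%C (fun t => (p t - 1) * h)%C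
  (fun t => exp 1 * Cmod h * Cmod h * t) (fun _ => exp 1 * Cmod h * Cmod h)).
- lra.
- intros t _. replace ((p t - 1) * h)%C with (p t * h - h)%C by ring.
  destruct (Dp t) as [D1 D2]. destruct (is_path_derive_line (RtoC 0) h t) as [D3 D4].
  split; simpl in *.
  + apply (is_derive_ext (fun s => fst (p s) - (0 + (s * fst h - 0 * snd h)))).
    intros; simpl; ring.
    exact (is_derive_minus (K:=R_AbsRing) (V:=R_NormedModule) _ _ t _ _ D1 D3).
  + apply (is_derive_ext (fun s => snd (p s) - (0 + (s * snd h + 0 * fst h)))).
    intros; simpl; ring.
    exact (is_derive_minus (K:=R_AbsRing) (V:=R_NormedModule) _ _ t _ _ D2 D4).
- intros; auto_derive; auto; ring.
- intros t Ht. rewrite Cmod_mult. apply Rmult_le_compat_r; auto.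
Qed.

Lemma has_cderiv_Cexp (z : C) : has_cderiv Cexp z (Cexp z).
Proof.
apply has_cderivP. intros eps Heps.
set (K := exp (fst z) * exp 1).
assert (HK : 0 < K) by (apply Rmult_lt_0_compat; apply exp_pos).
exists (Rmin 1 (eps / K)). split. apply Rmin_glb_lt. lra. now apply Rdiv_lt_0_compat.
intros h Hh.
pose proof (Rlt_le_trans _ _ _ Hh (Rmin_l _ _)) as Hh1.
pose proof (Rlt_le_trans _ _ _ Hh (Rmin_r _ _)) as Hh2.
rewrite Cexp_plus.
replace (Cexp z * Cexp h - Cexp z - Cexp z * h)%C with (Cexp z * (Cexp h - 1 - h))%C by ring.
rewrite Cmod_mult, Cmod_Cexp.
apply Rle_trans with (K * Cmod h * Cmod h).
- unfold K. rewrite !Rmult_assoc. apply Rmult_le_compat_l. left; apply exp_pos.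
  rewrite <- Rmult_assoc. apply Cexp_taylor. lra.
- apply Rmult_le_compat_r. apply Cmod_ge_0. apply Rlt_div_r in Hh2; auto. lra.
Qed.

(* In the logarithmic coordinate the punctured disc is a half-plane and the circle [|zeta| = rho] a vertical
   segment; by periodicity the horizontal sides cancel in Goursat's theorem, so circular means do not depend on the radius. *)
Lemma punctured_disc_max (Phi : C -> C) (L : C) (rho rr M : R) : 0 < rho < rr ->
  (forall w : C, 0 < Cmod w < rr -> exists l, has_cderiv Phi w l) ->
  (forall eps, 0 < eps -> exists delta, 0 < delta /\
     forall w : C, 0 < Cmod w < delta -> Cmod (Phi w - L)%C <= eps) ->
  (forall w : C, Cmod w = rho -> Cmod (Phi w) <= M) ->
  Cmod L <= M.
Proof.
intros Hrho Hol Hlim HM.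
set (F := fun w => Phi (Cexp w)).
pose proof PI_RGT_0 as HPI.
assert (HF : forall x y, x <= ln rho -> exists l, has_cderiv F (x, y) l).
{ intros x y Hx. destruct (Hol (Cexp (x, y))) as [l Hl].
  - rewrite Cmod_Cexp. cbn [fst]. split. apply exp_pos.
    assert (exp x <= exp (ln rho)).
    { destruct Hx as [Hx| ->]; [left; now apply exp_increasing | lra]. }
    rewrite exp_ln in H; lra.
  - eexists. apply (has_cderiv_comp Phi Cexp); eauto. apply has_cderiv_Cexp. }
assert (Pv : forall x y, x <= ln rho -> path_continuous (fun t => Ci * F (x, t))%C y).
{ intros x y Hx. destruct (HF x y Hx) as [l Hl]. eapply path_continuous_v; eauto. }
apply le_epsilon. intros eps Heps.
destruct (Hlim eps Heps) as [d [Hd Hd1]].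
(* The circle of radius [exp x0] is no larger than that of radius [rho] and lies where [Phi] is
   within [eps] of [L]. *)
set (x0 := Rmin (ln rho) (ln (d / 2))).
assert (Hx0 : x0 <= ln rho) by apply Rmin_l.
assert (G := goursat F x0 (ln rho) 0 (2 * PI) Hx0 ltac:(lra)).
assert (G1 : rect_int F x0 (ln rho) 0 (2 * PI) = RtoC 0).
{ apply G. intros x y Hx Hy. apply HF. lra. }
assert (E : hside F (2 * PI) x0 (ln rho) = hside F 0 x0 (ln rho)).
{ apply RIntC_ext; auto. intros t _. unfold F, Cexp. cbn [fst snd].
  now rewrite cos_2PI, sin_2PI, cos_0, sin_0. }
assert (V : vside F (ln rho) 0 (2 * PI) = vside F x0 0 (2 * PI)).
{ unfold rect_int in G1. rewrite E in G1.
  replace (vside F (ln rho) 0 (2 * PI)) with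
   ((hside F 0 x0 (ln rho) + vside F (ln rho) 0 (2 * PI) - hside F 0 x0 (ln rho)
    - vside F x0 0 (2 * PI)) + vside F x0 0 (2 * PI))%C by ring.
  rewrite G1. ring. }
assert (B1 : Cmod (vside F (ln rho) 0 (2 * PI)) <= M * (2 * PI - 0)).
{ apply RIntC_bound. lra. intros; apply Pv; lra.
  intros t _. rewrite Cmod_mult, Cmod_Ci, Rmult_1_l. apply HM.
  rewrite Cmod_Cexp. apply exp_ln. lra. }
assert (B2 : Cmod (vside F x0 0 (2 * PI) - (Ci * L) * RtoC (2 * PI - 0))%C <= eps * Rabs (2 * PI - 0)).
{ apply RIntC_near_const. intros; apply Pv; auto.
  intros t _. replace (Ci * F (x0, t) - Ci * L)%C with (Ci * (F (x0, t) - L))%C by ring.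
  rewrite Cmod_mult, Cmod_Ci, Rmult_1_l. apply Hd1. rewrite Cmod_Cexp. cbn [fst].
  split. apply exp_pos.
  assert (exp x0 <= exp (ln (d / 2))).
  { destruct (Rmin_r (ln rho) (ln (d / 2))) as [Hx| Hx]; fold x0 in Hx;
    [left; now apply exp_increasing | rewrite Hx; lra]. }
  rewrite exp_ln in H; lra. }
rewrite Rabs_right in B2 by lra. rewrite V in B1.
set (I := vside F x0 0 (2 * PI)) in *.
assert (B3 : Cmod (Ci * L * RtoC (2 * PI - 0))%C <= (M + eps) * (2 * PI)).
{ replace (Ci * L * RtoC (2 * PI - 0))%C with (I - (I - Ci * L * RtoC (2 * PI - 0)))%C by ring.
  eapply Rle_trans. apply (Cmod_triangle I (- (I - Ci * L * RtoC (2 * PI - 0)))%C).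
  rewrite Cmod_opp. lra. }
rewrite !Cmod_mult, Cmod_Ci, Cmod_R, Rabs_right in B3 by lra. nra.
Qed.

Lemma has_cderiv_translate (f : C -> C) (a w l : C) :
  has_cderiv f (a + w)%C l -> has_cderiv (fun v => f (a + v)%C) w l.
Proof.
rewrite !has_cderivP. intros H eps Heps. destruct (H eps Heps) as [d [Hd K]].
exists d. split; auto. intros h Hh. rewrite Cplus_assoc. auto.
Qed.

(* Applying the bound to the difference quotient costs only the factor 2 and avoids Cauchy's integral formula. *)
Lemma cauchy_estimate (f : C -> C) (a l : C) (rho rr M : R) : 0 < rho < rr ->
  (forall w : C, Cmod w < rr -> exists l, has_cderiv f (a + w)%C l) ->
  (forall w : C, Cmod w <= rho -> Cmod (f (a + w)%C) <= M) ->
  has_cderiv f a l -> Cmod l <= 2 * M / rho.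
Proof.
intros Hrho Hol HM Hl.
apply (punctured_disc_max (fun w => (f (a + w) - f a) * / w)%C l rho rr); auto.
- intros w Hw. destruct (Hol w) as [m Hm]. lra. eexists.
  apply (has_cderiv_mul (fun w => f (a + w) - f a)%C (fun w => / w)%C).
  + apply (has_cderiv_sub (fun w => f (a + w)%C) (fun _ => f a)).
    apply has_cderiv_translate. eauto. apply has_cderiv_const.
  + apply has_cderiv_inv. apply Cmod_gt_0. lra.
- intros eps Heps. destruct (proj1 (has_cderivP f a l) Hl eps Heps) as [d [Hd K]].
  exists d. split; auto. intros w [Hw1 Hw2]. specialize (K w Hw2).
  assert (Nw : w <> RtoC 0) by (apply Cmod_gt_0; auto).
  replace ((f (a + w) - f a) * / w - l)%C with ((f (a + w) - f a - l * w) / w)%C by (field; auto).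
  rewrite Cmod_div by auto. apply Rle_div_l; auto.
- intros w Hw.
  assert (Nw : w <> RtoC 0) by (apply Cmod_gt_0; lra).
  rewrite Cmod_mult, Cmod_inv, Hw by auto.
  pose proof (HM w ltac:(lra)) as M1. pose proof (HM (RtoC 0) ltac:(rewrite Cmod_0; lra)) as M2.
  replace (a + 0)%C with a in M2 by ring.
  pose proof (Cmod_triangle (f (a + w)%C) (- f a)%C) as T. rewrite Cmod_opp in T.
  apply Rmult_le_compat_r. left; apply Rinv_0_lt_compat; lra.
  change (Cmod (f (a + w) + - f a)%C <= 2 * M). lra.
Qed.

(** * Weights, boundary values and limits of analytic functions *)

(** Divided by |1 + conj(a) w|^2, this evaluates 1 - |phi(w)|^2 for the automorphism phi(w) = (a +
    w) / (1 + conj(a) w). *)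
Lemma moebius_identity (a w : C) :
  Cmod (1 + Cconj a * w)%C ^ 2 - Cmod (a + w)%C ^ 2 = (1 - Cmod a ^ 2) * (1 - Cmod w ^ 2).
Proof. rewrite !Cmod2_alt. destruct a, w. simpl. ring. Qed.

(* The disc automorphism taking 0 to [a] turns the mean value estimate at the centre into one at [a]. *)
Lemma vanish_at_boundary (g : C -> C) : holoD g ->
  (forall eps, 0 < eps -> exists r, r < 1 /\ forall z : C, r < Cmod z < 1 -> Cmod (g z) <= eps) ->
  forall z : C, Cmod z < 1 -> g z = RtoC 0.
Proof.
intros Hg Hlim a Ha.
apply Cmod_eq_0. apply Rle_antisym; [|apply Cmod_ge_0].
apply le_epsilon. intros eps Heps. rewrite Rplus_0_l.
destruct (Hlim eps Heps) as [r0 [Hr0 Hr]].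
(* [r0] may be negative, while 0 < r < 1 is needed at the end: there |phi(w)|^2 >= r > r^2 yields
   |phi(w)| > r. *)
set (r := Rmax r0 (1 / 2)).
assert (Hr1 : 1 / 2 <= r < 1) by (unfold r; split; [apply Rmax_r | apply Rmax_lub_lt; lra]).
pose proof (Cmod_ge_0 a) as A0.
(* On the circle |w| = 1 - eta/2 one has 1 - |w|^2 <= eta; dividing by |1 + conj(a) w|^2 >= (1 -
   |a|)^2 leaves 1 - |phi(w)|^2 <= 1 - r. *)
set (eta := (1 - r) * (1 - Cmod a) ^ 2).
assert (P1 : 0 < (1 - Cmod a) ^ 2) by (apply pow_lt; lra).
assert (P2 : (1 - Cmod a) ^ 2 <= 1) by nra.
assert (Heta : 0 < eta <= 1) by (unfold eta; nra).
set (N := fun w => (1 + Cconj a * w)%C).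
assert (HN : forall w, Cmod w < 1 -> 1 - Cmod a <= Cmod (N w)).
{ intros w Hw. pose proof (Cmod_sub_le 1 (Cconj a * w)%C) as T.
  rewrite Cmod_1, Cmod_mult, Cmod_conj in T. unfold N. pose proof (Cmod_ge_0 w). nra. }
assert (HN0 : forall w, Cmod w < 1 -> N w <> RtoC 0).
{ intros w Hw. apply Cmod_gt_0. specialize (HN w Hw). lra. }
set (phi := fun w => ((a + w) * / N w)%C).
assert (Hphi : forall w, Cmod w < 1 ->
  1 - Cmod (phi w) ^ 2 = (1 - Cmod a ^ 2) * (1 - Cmod w ^ 2) / Cmod (N w) ^ 2).
{ intros w Hw. rewrite <- moebius_identity. unfold phi. rewrite Cmod_mult, Cmod_inv by auto.
  specialize (HN w Hw). fold (N w). field. lra. }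
assert (Hphi1 : forall w, Cmod w < 1 -> Cmod (phi w) < 1).
{ intros w Hw. specialize (Hphi w Hw). specialize (HN w Hw).
  pose proof (Cmod_ge_0 w). pose proof (Cmod_ge_0 (phi w)).
  assert (0 < (1 - Cmod a ^ 2) * (1 - Cmod w ^ 2) / Cmod (N w) ^ 2).
  { apply Rdiv_lt_0_compat. apply Rmult_lt_0_compat; nra. apply pow_lt; lra. }
  nra. }
assert (Hol : forall w, Cmod w < 1 -> exists l, has_cderiv (fun w => g (phi w)) w l).
{ intros w Hw. destruct (Hg (phi w)) as [l Hl]. apply inD_Cmod; auto.
  eexists. apply (has_cderiv_comp g phi); eauto.
  apply (has_cderiv_mul (fun w => a + w)%C (fun w => / N w)%C).
  - apply (has_cderiv_translate (fun v => v)). apply has_cderiv_id.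
  - apply (has_cderiv_comp (fun v => / v)%C N). apply has_cderiv_inv; auto.
    eapply has_cderiv_ext_loc with (f := fun v => (1 - (- Cconj a) * v)%C) (r := 1). lra.
    intros; unfold N; ring.
    apply (has_cderiv_sub (fun _ => RtoC 1) (fun v => (- Cconj a) * v)%C).
    apply has_cderiv_const. apply (has_cderiv_scal _ (fun v => v)). apply has_cderiv_id. }
assert (E0 : phi (RtoC 0) = a).
{ unfold phi, N. replace (1 + Cconj a * 0)%C with (RtoC 1) by ring. field. }
apply (punctured_disc_max (fun w => g (phi w)) (g a) (1 - eta / 2) 1 eps).
- lra.
- intros w Hw. apply Hol. lra.
- intros e He. destruct (Hol (RtoC 0)) as [l Hl]. rewrite Cmod_0; lra.
  destruct (has_cderiv_cont _ _ _ Hl e He) as [d [Hd K]].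
  exists d. split; auto. intros w Hw. specialize (K w (proj2 Hw)).
  rewrite E0 in K. replace (0 + w)%C with w in K by ring. lra.
- intros w Hw. apply Hr. assert (Hw1 : Cmod w < 1) by lra. split; auto.
  apply Rle_lt_trans with r. apply Rmax_l.
  specialize (Hphi w Hw1). specialize (HN w Hw1).
  pose proof (Cmod_ge_0 (phi w)) as F0.
  assert (Q : (1 - Cmod a ^ 2) * (1 - Cmod w ^ 2) / Cmod (N w) ^ 2 <= 1 - r).
  { apply Rle_div_l. apply pow_lt; lra.
    assert ((1 - Cmod a ^ 2) * (1 - Cmod w ^ 2) <= eta).
    { assert (1 - Cmod w ^ 2 <= eta) by (rewrite Hw; nra).
      assert (0 <= 1 - Cmod w ^ 2) by (rewrite Hw; nra). nra. }
    assert ((1 - Cmod a) ^ 2 <= Cmod (N w) ^ 2) by (apply pow_incr; lra).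
    unfold eta in *. nra. }
  rewrite <- Hphi in Q.
  destruct (Rle_lt_dec (Cmod (phi w)) r) as [L|]; auto. exfalso.
  specialize (Hphi1 w Hw1). nra.
Qed.

Lemma weight_Cmod (a : R) (z : C) : weight a z = Rpower (1 - Cmod z ^ 2) a.
Proof. unfold weight. now rewrite Cmod_Complex. Qed.

Lemma weight_pos (a : R) (z : C) : 0 < weight a z.
Proof. apply exp_pos. Qed.

Lemma weight_plus (a b : R) (z : C) : weight (a + b) z = weight a z * weight b z.
Proof. apply Rpower_plus. Qed.

Lemma weight_1 (z : C) : Cmod z < 1 -> weight 1 z = 1 - Cmod z ^ 2.
Proof. intros H. rewrite weight_Cmod, Rpower_1; auto. pose proof (Cmod_ge_0 z). nra. Qed.

Lemma weight_le (a t : R) (z : C) : 0 <= a -> Cmod z < 1 -> 1 - Cmod z ^ 2 <= t ->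
  weight a z <= Rpower t a.
Proof.
intros Ha Hz Ht. rewrite weight_Cmod. apply Rle_Rpower_l; auto.
pose proof (Cmod_ge_0 z). nra.
Qed.

Lemma weight_ge (a t : R) (z : C) : 0 <= a -> 0 < t <= 1 - Cmod z ^ 2 ->
  Rpower t a <= weight a z.
Proof. intros Ha Ht. rewrite weight_Cmod. apply Rle_Rpower_l; auto. Qed.

Lemma weight_le_1 (a : R) (z : C) : 0 <= a -> Cmod z < 1 -> weight a z <= 1.
Proof.
intros Ha Hz. replace 1 with (Rpower 1 a).
- apply weight_le; auto. pose proof (pow2_ge_0 (Cmod z)). lra.
- unfold Rpower. now rewrite ln_1, Rmult_0_r, exp_0.
Qed.

(** The constant comes from 1 - |z|^2 <= 2 (1 - |z|) <= 4 (1 - |w|) <= 4 (1 - |w|^2). *)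
Lemma weight_nearby (a : R) (z w : C) : 0 <= a -> Cmod z < 1 ->
  Cmod w <= (1 + Cmod z) / 2 -> weight a z <= Rpower 4 a * weight a w.
Proof.
intros Ha Hz Hw. pose proof (Cmod_ge_0 z). pose proof (Cmod_ge_0 w).
rewrite (weight_Cmod a w), Rpower_mult_distr; try nra.
apply weight_le; auto. nra.
Qed.

(** The Cauchy estimate on the disc of radius (1 - |z|)/2 about [z], where [weight_nearby] costs
    4^a. The 8 is a product of three factors 2: from the difference quotient, from halving the
    radius, and from 1 - |z|^2 <= 2 (1 - |z|). *)
Lemma weighted_cauchy_estimate (a B : R) (f : C -> C) (z l : C) : 0 <= a -> holoD f ->
  (forall w : C, inD w -> weight a w * Cmod (f w) <= B) ->
  Cmod z < 1 -> has_cderiv f z l ->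
  weight (a + 1) z * Cmod l <= 8 * Rpower 4 a * B.
Proof.
intros Ha Hf HB Hz Hl. pose proof (weight_pos a z) as W0.
set (M := Rpower 4 a * B / weight a z).
assert (HM : Cmod l <= 2 * M / ((1 - Cmod z) / 2)).
{ apply (cauchy_estimate f z l _ (1 - Cmod z)); auto.
  - lra.
  - intros w Hw. apply Hf. apply inD_Cmod. pose proof (Cmod_triangle z w). lra.
  - intros w Hw. pose proof (Cmod_triangle z w) as T.
    assert (HD : inD (z + w)%C) by (apply inD_Cmod; lra).
    specialize (HB _ HD).
    pose proof (weight_nearby a z (z + w)%C Ha Hz ltac:(lra)) as N.
    apply Rle_div_r; auto.
    apply Rle_trans with (Cmod (f (z + w)%C) * (Rpower 4 a * weight a (z + w)%C)).
    apply Rmult_le_compat_l; auto. apply Cmod_ge_0.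
    assert (0 < Rpower 4 a) by apply exp_pos. nra. }
rewrite weight_plus, weight_1 by auto.
assert (MW : M * weight a z = Rpower 4 a * B) by (unfold M; field; lra).
replace (8 * Rpower 4 a * B) with (8 * (M * weight a z)) by (rewrite MW; ring).
apply Rle_div_r in HM; [|lra].
pose proof (Cmod_ge_0 l). pose proof (Cmod_ge_0 z).
assert (0 <= (1 - Cmod z) * ((1 - Cmod z) * Cmod l)) by (apply Rmult_le_pos; nra).
assert ((1 - Cmod z ^ 2) * Cmod l <= 8 * M) by nra.
nra.
Qed.

Lemma holoD_sub (f g : C -> C) : holoD f -> holoD g -> holoD (fun z => f z - g z)%C.
Proof.
intros Hf Hg z Hz. destruct (Hf z Hz), (Hg z Hz). eexists. apply (has_cderiv_sub f g); eauto.
Qed.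

Lemma C_complete (u : nat -> C) :
  (forall eps, 0 < eps -> exists N, forall m n, (N <= m)%nat -> (N <= n)%nat ->
     Cmod (u m - u n)%C <= eps) ->
  exists l : C, forall eps, 0 < eps -> exists N, forall n, (N <= n)%nat -> Cmod (u n - l)%C <= eps.
Proof.
intros H.
assert (K : forall pr : C -> R, (forall z w, Rabs (pr z - pr w) <= Cmod (z - w)%C) ->
  exists l, forall eps, 0 < eps -> exists N, forall n, (N <= n)%nat -> Rabs (pr (u n) - l) <= eps).
{ intros pr Hpr. destruct (Rcomplete.R_complete (fun n => pr (u n))) as [l Hl].
  - intros eps Heps. destruct (H (eps / 2)) as [N HN]. lra.
    exists N. intros n m Hn Hm. unfold Rdist. eapply Rle_lt_trans; [apply Hpr|].
    specialize (HN n m Hn Hm). lra.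
  - exists l. intros eps Heps. destruct (Hl eps Heps) as [N HN]. exists N.
    intros n Hn. left. now apply HN. }
destruct (K fst) as [x Hx]. { intros z w. apply (Rabs_fst_le (z - w)%C). }
destruct (K snd) as [y Hy]. { intros z w. apply (Rabs_snd_le (z - w)%C). }
exists (x, y). intros eps Heps.
destruct (Hx (eps / 2)) as [N1 H1]. lra. destruct (Hy (eps / 2)) as [N2 H2]. lra.
exists (max N1 N2). intros n Hn.
eapply Rle_trans; [apply Cmod_le_sum|]. specialize (H1 n ltac:(lia)). specialize (H2 n ltac:(lia)).
simpl in *. unfold Rminus in *. lra.
Qed.

Lemma Cmod_sub_triangle (a b c : C) : Cmod (a - c)%C <= Cmod (a - b)%C + Cmod (b - c)%C.
Proof. replace (a - c)%C with ((a - b) + (b - c))%C by ring. apply Cmod_triangle. Qed.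

Lemma Cmod_sub_sym (a b : C) : Cmod (a - b)%C = Cmod (b - a)%C.
Proof. rewrite <- Cmod_opp. f_equal. ring. Qed.

Lemma lipschitz_segment (f df : C -> C) (z k : C) (L : R) :
  (forall t, 0 <= t <= 1 -> has_cderiv f (z + RtoC t * k)%C (df (z + RtoC t * k)%C)) ->
  (forall t, 0 <= t <= 1 -> Cmod (df (z + RtoC t * k)%C) <= L) ->
  Cmod (f (z + k) - f z)%C <= L * Cmod k.
Proof.
intros Hf HL. replace (L * Cmod k) with (L * Cmod k * 1 - L * Cmod k * 0) by ring.
apply (segment_increment_le f df z k (fun t => L * Cmod k * t) (fun _ => L * Cmod k)); auto.
- intros; auto_derive; auto; ring.
- intros t Ht. apply Rmult_le_compat_r; auto. apply Cmod_ge_0.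
Qed.

(** By the weighted Cauchy estimate the derivatives are uniformly Cauchy near [z], so [hs n - h] has
    a small Lipschitz constant there, and differentiability passes from one [hs n] to [h]. *)
Lemma weierstrass (b : R) (hs : nat -> C -> C) (h : C -> C) : 0 <= b ->
  (forall n, holoD (hs n)) ->
  (forall eps, 0 < eps -> exists N, forall n, (N <= n)%nat -> forall z : C, inD z ->
     weight b z * Cmod (hs n z - h z)%C <= eps) ->
  holoD h.
Proof.
intros Hb Hol Hlim z Hz. pose proof (proj1 (inD_Cmod z) Hz) as Hz1.
set (dn := fun n w => epsilon (inhabits C0) (has_cderiv (hs n) w)).
assert (Hdn : forall n w, inD w -> has_cderiv (hs n) w (dn n w)).
{ intros n w Hw. apply epsilon_spec. now apply Hol. }
(* The factor from weighted distances of values to distances of derivatives near [z]: twice the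
   Cauchy constant, for two functions each compared with [h], times the loss in moving the weight
   from [w] to [z]. *)
set (c := 16 * Rpower 4 b * Rpower 4 (b + 1) / weight (b + 1) z).
assert (Hc : 0 < c).
{ apply Rdiv_lt_0_compat; [|apply weight_pos]. repeat apply Rmult_lt_0_compat; try apply exp_pos; lra. }
assert (Near : forall w : C, Cmod (w - z)%C <= (1 - Cmod z) / 2 ->
  Cmod w <= (1 + Cmod z) / 2 /\ inD w).
{ intros w Hw. pose proof (Cmod_triangle (w - z)%C z) as T.
  replace (w - z + z)%C with w in T by ring. split. lra. apply inD_Cmod. lra. }
assert (Dc : forall eps, 0 < eps -> exists N, forall m n, (N <= m)%nat -> (N <= n)%nat ->
  forall w : C, Cmod (w - z)%C <= (1 - Cmod z) / 2 -> Cmod (dn m w - dn n w)%C <= eps).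
{ intros eps Heps. destruct (Hlim (eps / c)) as [N HN]. now apply Rdiv_lt_0_compat.
  exists N. intros m n Hm Hn w Hw. destruct (Near w Hw) as [Hw1 Hw2].
  assert (Q : weight (b + 1) w * Cmod (dn m w - dn n w)%C <= 8 * Rpower 4 b * (2 * (eps / c))).
  { apply (weighted_cauchy_estimate b _ (fun z => hs m z - hs n z)%C); auto.
    - now apply holoD_sub.
    - intros v Hv. pose proof (HN m Hm v Hv) as K1. pose proof (HN n Hn v Hv) as K2.
      pose proof (Cmod_sub_triangle (hs m v) (h v) (hs n v)) as T.
      rewrite (Cmod_sub_sym (h v)) in T. pose proof (weight_pos b v). nra.
    - now apply inD_Cmod.
    - apply has_cderiv_sub; auto. }
  pose proof (weight_nearby (b + 1) z w ltac:(lra) Hz1 Hw1) as W.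
  pose proof (Cmod_ge_0 (dn m w - dn n w)%C) as P.
  apply Rmult_le_reg_l with (weight (b + 1) z). apply weight_pos.
  apply Rle_trans with (Rpower 4 (b + 1) * (weight (b + 1) w * Cmod (dn m w - dn n w)%C)).
  { rewrite <- Rmult_assoc. now apply Rmult_le_compat_r. }
  apply Rle_trans with (Rpower 4 (b + 1) * (8 * Rpower 4 b * (2 * (eps / c)))).
  { apply Rmult_le_compat_l; auto. left; apply exp_pos. }
  right. unfold c. field. split; [|split]; apply Rgt_not_eq; try apply weight_pos; apply exp_pos. }
destruct (C_complete (fun n => dn n z)) as [l Hl].
{ intros eps Heps. destruct (Dc eps Heps) as [N HN]. exists N. intros m n Hm Hn.
  apply HN; auto. replace (z - z)%C with (RtoC 0) by ring. rewrite Cmod_0. lra. }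
exists l. apply has_cderivP. intros eps Heps.
destruct (Dc (eps / 4)) as [N1 HN1]. lra.
destruct (Hl (eps / 4)) as [N2 HN2]. lra.
set (n := max N1 N2).
destruct (proj1 (has_cderivP (hs n) z (dn n z)) (Hdn n z Hz) (eps / 2)) as [d [Hd K]]. lra.
exists (Rmin d ((1 - Cmod z) / 2)). split. apply Rmin_glb_lt; lra.
intros k Hk.
pose proof (Rlt_le_trans _ _ _ Hk (Rmin_l _ _)) as Hk1.
pose proof (Rlt_le_trans _ _ _ Hk (Rmin_r _ _)) as Hk2.
specialize (K k Hk1). specialize (HN2 n ltac:(lia)).
assert (Hzk : inD (z + k)%C).
{ apply Near. replace (z + k - z)%C with k by ring. lra. }
(* The Lipschitz bound holds for [hs n - hs m]. An index [m] depending on [k] and on the slack [e]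
   replaces [hs m] by [h] at the two points involved. *)
assert (Q : Cmod ((hs n (z + k) - h (z + k)) - (hs n z - h z))%C <= eps / 4 * Cmod k).
{ apply le_epsilon. intros e He.
  set (s := Rmin (weight b z) (weight b (z + k)%C)).
  assert (Hs : 0 < s) by (apply Rmin_glb_lt; apply weight_pos).
  destruct (Hlim (e / 2 * s)) as [N3 HN3]. apply Rmult_lt_0_compat; lra.
  set (m := max n N3).
  assert (Pt : forall w : C, inD w -> s <= weight b w -> Cmod (hs m w - h w)%C <= e / 2).
  { intros w Hw Hsw. specialize (HN3 m ltac:(lia) w Hw).
    pose proof (Cmod_ge_0 (hs m w - h w)%C). apply Rmult_le_reg_l with s; nra. }
  pose proof (Pt z Hz (Rmin_l _ _)) as Q1. pose proof (Pt (z + k)%C Hzk (Rmin_r _ _)) as Q2.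
  assert (Q3 : Cmod ((hs n (z + k) - hs m (z + k)) - (hs n z - hs m z))%C <= eps / 4 * Cmod k).
  { apply (lipschitz_segment (fun w => hs n w - hs m w)%C (fun w => dn n w - dn m w)%C).
    - intros t Ht. apply has_cderiv_sub; apply Hdn; apply Near;
      replace (z + RtoC t * k - z)%C with (RtoC t * k)%C by ring;
      rewrite Cmod_mult, Cmod_R, Rabs_right by lra; nra.
    - intros t Ht. apply HN1; try lia.
      replace (z + RtoC t * k - z)%C with (RtoC t * k)%C by ring.
      rewrite Cmod_mult, Cmod_R, Rabs_right by lra. nra. }
  replace ((hs n (z + k) - h (z + k)) - (hs n z - h z))%C with
    (((hs n (z + k) - hs m (z + k)) - (hs n z - hs m z)) +
     ((hs m (z + k) - h (z + k)) - (hs m z - h z)))%C by ring.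
  eapply Rle_trans; [apply Cmod_triangle|].
  pose proof (Cmod_triangle (hs m (z + k) - h (z + k))%C (- (hs m z - h z))%C) as T.
  rewrite Cmod_opp in T.
  change (Cmod ((hs m (z + k) - h (z + k)) - (hs m z - h z))%C <=
    Cmod (hs m (z + k) - h (z + k))%C + Cmod (hs m z - h z)%C) in T. lra. }
replace (h (z + k) - h z - l * k)%C with
  ((hs n (z + k) - hs n z - dn n z * k) + (- ((hs n (z + k) - h (z + k)) - (hs n z - h z))
   + (dn n z - l) * k))%C by ring.
eapply Rle_trans; [apply Cmod_triangle|].
pose proof (Cmod_triangle (- ((hs n (z + k) - h (z + k)) - (hs n z - h z)))%C
  ((dn n z - l) * k)%C) as T. rewrite Cmod_opp, Cmod_mult in T.
pose proof (Cmod_ge_0 k). nra.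
Qed.

(** Radial integration: with x = |z|, the derivative along the radius is at most A + B x (1 - t
    x)^(-b-1), whose antiderivative is A t + (B/b) (1 - t x)^(-b). The factor 2^b comes from 1 -
    |z|^2 <= 2 (1 - |z|). *)
Lemma weighted_primitive_bound (b r A B : R) (H dH : C -> C) : 0 < b -> 0 <= A -> 0 <= B ->
  (forall z : C, Cmod z < 1 -> has_cderiv H z (dH z)) -> H (RtoC 0) = RtoC 0 ->
  (forall z : C, Cmod z < 1 -> Cmod z <= r -> Cmod (dH z) <= A) ->
  (forall z : C, r < Cmod z < 1 -> weight (b + 1) z * Cmod (dH z) <= B) ->
  forall z : C, Cmod z < 1 -> weight b z * Cmod (H z) <= A + B * (Rpower 2 b / b).
Proof.
intros Hb HA HB Hd H0 H1 H2 z Hz. set (x := Cmod z) in *.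
assert (Hx : 0 <= x) by apply Cmod_ge_0.
assert (Rp : forall t, 0 < Rpower (1 - t * x) (- b - 1)) by (intros; apply exp_pos).
assert (Bd : Cmod (H (0 + z) - H 0)%C <=
  (A * 1 + B * (Rpower (1 - 1 * x) (- b) / b)) - (A * 0 + B * (Rpower (1 - 0 * x) (- b) / b))).
{ apply (segment_increment_le H dH (RtoC 0) z
   (fun t => A * t + B * (Rpower (1 - t * x) (- b) / b))
   (fun t => A + B * (x * Rpower (1 - t * x) (- b - 1)))).
  - intros t Ht. apply Hd. rewrite Cplus_0_l, Cmod_mult, Cmod_R, Rabs_right by lra.
    fold x. nra.
  - intros t Ht. assert (U : 0 < 1 - t * x) by nra.
    replace (Rpower (1 - t * x) (- b - 1)) with (Rpower (1 - t * x) (- b) * / (1 - t * x)).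
    2:{ replace (- b - 1) with (- b + - (1)) by ring. rewrite Rpower_plus, (Rpower_Ropp _ 1), Rpower_1 by auto. ring. }
    unfold Rpower. auto_derive. auto. unfold Rminus. field. lra.
  - intros t Ht. set (w := (0 + RtoC t * z)%C).
    assert (Ew : Cmod w = t * x).
    { unfold w. rewrite Cplus_0_l, Cmod_mult, Cmod_R, Rabs_right by lra. reflexivity. }
    assert (Hw : Cmod w < 1) by (rewrite Ew; nra).
    fold x. pose proof (Rp t) as Rpt. pose proof (Cmod_ge_0 (dH w)) as G0.
    destruct (Rle_lt_dec (Cmod w) r) as [L|L].
    + specialize (H1 w Hw L).
      assert (0 <= B * (x * Rpower (1 - t * x) (- b - 1))).
      { apply Rmult_le_pos; auto. apply Rmult_le_pos; lra. }
      nra.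
    + specialize (H2 w (conj L Hw)).
      assert (U : 0 < 1 - t * x) by nra.
      assert (W : Rpower (1 - t * x) (b + 1) <= weight (b + 1) w).
      { apply weight_ge. lra. rewrite Ew. split; auto. pose proof (Cmod_ge_0 w). nra. }
      assert (W0 : 0 < Rpower (1 - t * x) (b + 1)) by apply exp_pos.
      assert (Q : Cmod (dH w) <= B * Rpower (1 - t * x) (- b - 1)).
      { replace (- b - 1) with (- (b + 1)) by ring. rewrite Rpower_Ropp.
        apply Rle_div_r; auto. nra. }
      nra. }
rewrite Cplus_0_l, H0 in Bd. replace (H z - 0)%C with (H z) in Bd by ring.
rewrite Rmult_1_l, Rmult_1_r, Rmult_0_r, Rmult_0_l in Bd.
assert (P0 : 0 <= B * (Rpower (1 - 0) (- b) / b)).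
{ apply Rmult_le_pos; auto. left. apply Rdiv_lt_0_compat; auto. apply exp_pos. }
assert (W1 : weight b z <= 1) by (apply weight_le_1; auto; lra).
assert (W2 : weight b z <= Rpower 2 b * Rpower (1 - x) b).
{ rewrite Rpower_mult_distr by lra. apply weight_le; auto; fold x; nra. }
pose proof (weight_pos b z) as W0.
assert (W3 : weight b z * Rpower (1 - x) (- b) <= Rpower 2 b).
{ rewrite Rpower_Ropp. apply Rle_div_l; auto. apply exp_pos. }
apply Rle_trans with (weight b z * (A + B * (Rpower (1 - x) (- b) / b))).
{ apply Rmult_le_compat_l; lra. }
replace (weight b z * (A + B * (Rpower (1 - x) (- b) / b))) with
  (weight b z * A + (B / b) * (weight b z * Rpower (1 - x) (- b))) by (field; lra).
replace (B * (Rpower 2 b / b)) with ((B / b) * Rpower 2 b) by (field; lra).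
apply Rplus_le_compat. nra. apply Rmult_le_compat_l; auto.
apply Rdiv_le_0_compat; auto.
Qed.

(** * Montel's theorem *)

Definition increasing_nat (phi : nat -> nat) : Prop := forall n, (phi n < phi (S n))%nat.

Lemma increasing_nat_lt (phi : nat -> nat) : increasing_nat phi ->
  forall m n, (m < n)%nat -> (phi m < phi n)%nat.
Proof.
intros H m n L. induction L as [|n L IH]. apply H. specialize (H n). lia.
Qed.

Lemma increasing_nat_ge (phi : nat -> nat) : increasing_nat phi -> forall n, (n <= phi n)%nat.
Proof. intros H n. induction n as [|n IH]. lia. specialize (H n). lia. Qed.

Lemma increasing_nat_comp (phi psi : nat -> nat) :
  increasing_nat phi -> increasing_nat psi -> increasing_nat (fun n => phi (psi n)).
Proof. intros H1 H2 n. apply increasing_nat_lt; auto. Qed.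

Lemma extraction (Q : nat -> nat -> Prop) :
  (forall n N, exists p, (N <= p)%nat /\ Q n p) ->
  exists theta, increasing_nat theta /\ forall n, Q n (theta n).
Proof.
intros H.
set (pick := fun n N => epsilon (inhabits O) (fun p => (N <= p)%nat /\ Q n p)).
assert (Hp : forall n N, (N <= pick n N)%nat /\ Q n (pick n N)).
{ intros n N. apply (epsilon_spec (inhabits O) (fun p => (N <= p)%nat /\ Q n p)). apply H. }
exists (fix th n := match n with O => pick O O | S k => pick (S k) (S (th k)) end).
split.
- intros n. apply Hp.
- intros [|n]; apply Hp.
Qed.

Lemma R_cluster (u : nat -> R) (B : R) : (forall n, Rabs (u n) <= B) ->
  exists l, forall d N, 0 < d -> exists p, (N <= p)%nat /\ Rabs (u p - l) < d.
Proof.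
intros H. destruct (Bolzano_Weierstrass u (fun x => - B <= x <= B)) as [l Hl].
- apply compact_P3.
- intros n. now apply Rabs_le_between.
- exists l. intros d N Hd. apply (Hl (disc l (mkposreal d Hd)) N).
  exists (mkposreal d Hd). intros x Hx. exact Hx.
Qed.

(** A subsequence whose real parts converge at rate 1/(n+1) is extracted first; a cluster point of
    its imaginary parts then serves both coordinates. *)
Lemma C_cluster (u : nat -> C) (B : R) : (forall n, Cmod (u n) <= B) ->
  exists l : C, forall d N, 0 < d -> exists p, (N <= p)%nat /\ Cmod (u p - l)%C < d.
Proof.
intros H.
destruct (R_cluster (fun n => fst (u n)) B) as [x Hx].
{ intros n. eapply Rle_trans; [apply Rabs_fst_le | auto]. }
destruct (extraction (fun n p => Rabs (fst (u p) - x) < / (INR n + 1))) as [th [T1 T2]].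
{ intros n N. apply Hx. apply Rinv_0_lt_compat. pose proof (pos_INR n). lra. }
destruct (R_cluster (fun n => snd (u (th n))) B) as [y Hy].
{ intros n. eapply Rle_trans; [apply Rabs_snd_le | auto]. }
exists (x, y). intros d N Hd.
destruct (archimed_cor1 (d / 2)) as [M [M1 M2]]. lra.
destruct (Hy (d / 2) (max N M)) as [p [Hp1 Hp2]]. lra.
exists (th p). pose proof (increasing_nat_ge th T1 p). split. lia.
eapply Rle_lt_trans; [apply Cmod_le_sum|]. simpl.
specialize (T2 p).
assert (/ (INR p + 1) < / INR M).
{ apply Rinv_lt_contravar. apply Rmult_lt_0_compat. now apply lt_0_INR.
  pose proof (pos_INR p). lra. assert (INR M <= INR p) by (apply le_INR; lia). lra. }
unfold Rminus in *. lra.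
Qed.

(** Keeps the terms within d/2 of a cluster point. Oscillation at most [d] is all one stage needs;
    smaller oscillations are left to [diagonal]. *)
Lemma C_pigeonhole (u : nat -> C) (B d : R) : (forall n, Cmod (u n) <= B) -> 0 < d ->
  exists theta, increasing_nat theta /\ forall m n, Cmod (u (theta m) - u (theta n))%C <= d.
Proof.
intros H Hd. destruct (C_cluster u B H) as [l Hl].
destruct (extraction (fun _ p => Cmod (u p - l)%C < d / 2)) as [th [T1 T2]].
{ intros _ N. apply Hl. lra. }
exists th. split; auto. intros m n.
eapply Rle_trans. apply (Cmod_sub_triangle _ l).
rewrite (Cmod_sub_sym l). pose proof (T2 m). pose proof (T2 n). lra.
Qed.

(** One refinement per point; oscillation bounds already won survive passing to a subsequence. [D]
    excludes grid points outside the region where the functions are bounded. *)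
Lemma pigeonhole_list (fs : nat -> C -> C) (D : C -> Prop) (B d : R) (ps : list C) :
  (forall n p, D p -> Cmod (fs n p) <= B) -> 0 < d ->
  exists theta, increasing_nat theta /\ forall p, In p ps -> D p ->
    forall m n, Cmod (fs (theta m) p - fs (theta n) p)%C <= d.
Proof.
intros HB Hd. induction ps as [|q ps [th [T1 T2]]].
- exists (fun n => n). split. intros n; lia. intros p [].
- destruct (classic (D q)) as [Sq|Sq].
  + destruct (C_pigeonhole (fun n => fs (th n) q) B d) as [th' [T3 T4]]; auto.
    exists (fun n => th (th' n)). split. now apply increasing_nat_comp.
    intros p [<-|Hp] Sp m n; auto.
  + exists th. split; auto. intros p [<-|Hp] Sp; auto. contradiction.
Qed.

(** [Psi k] refines its predecessor so that stage [k] holds for all its pairs. From index [k] on,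
    the diagonal takes only values of [Psi k]. *)
Lemma diagonal (P : nat -> nat -> nat -> Prop) :
  (forall k psi, increasing_nat psi -> exists theta, increasing_nat theta /\
     forall m n, P k (psi (theta m)) (psi (theta n))) ->
  exists phi, increasing_nat phi /\ forall k m n, (k <= m)%nat -> (k <= n)%nat -> P k (phi m) (phi n).
Proof.
intros H.
set (th := fun k psi => epsilon (inhabits (fun n : nat => n)) (fun theta => increasing_nat theta /\
     forall m n, P k (psi (theta m)) (psi (theta n)))).
assert (Hth : forall k psi, increasing_nat psi -> increasing_nat (th k psi) /\
     forall m n, P k (psi (th k psi m)) (psi (th k psi n))).
{ intros k psi Hpsi. apply (epsilon_spec (inhabits (fun n : nat => n))
   (fun theta => increasing_nat theta /\ forall m n, P k (psi (theta m)) (psi (theta n)))). auto. }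
set (Psi := fix Psi k := match k with
  | O => fun n => th O (fun n => n) n
  | S j => fun n => Psi j (th (S j) (Psi j) n) end).
assert (I : forall k, increasing_nat (Psi k)).
{ induction k as [|k IH]. apply (Hth O (fun n => n)). intros n; lia.
  apply (increasing_nat_comp (Psi k)); auto. now apply Hth. }
assert (J : forall k m n, P k (Psi k m) (Psi k n)).
{ intros [|k]. apply (Hth O (fun n => n)). intros n; lia.
  apply (Hth (S k) (Psi k)). apply I. }
assert (K : forall k i n, exists n', Psi (k + i)%nat n = Psi k n').
{ intros k i. induction i as [|i IH]; intros n.
  - exists n. now rewrite Nat.add_0_r.
  - rewrite Nat.add_succ_r. apply IH. }
exists (fun n => Psi n n). split.
- intros n. change (Psi n n < Psi n (th (S n) (Psi n) (S n)))%nat.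
  apply (increasing_nat_lt (Psi n) (I n)).
  destruct (Hth (S n) (Psi n) (I n)) as [T _].
  pose proof (increasing_nat_ge _ T (S n)). lia.
- intros k m n Hm Hn.
  destruct (K k (m - k)%nat m) as [m' Em]. destruct (K k (n - k)%nat n) as [n' En].
  replace (k + (m - k))%nat with m in Em by lia. replace (k + (n - k))%nat with n in En by lia.
  rewrite Em, En. apply J.
Qed.

Lemma interval_net (N : nat) (x : R) : (0 < N)%nat -> -1 <= x <= 1 ->
  exists i, (i < 2 * N + 1)%nat /\ Rabs (x - (INR i / INR N - 1)) <= / INR N.
Proof.
intros HN Hx. assert (P : 0 < INR N) by now apply lt_0_INR.
destruct (nfloor_ex ((x + 1) * INR N)) as [i [I1 I2]]. apply Rmult_le_pos; lra.
exists i. split.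
- apply INR_lt. rewrite plus_INR, mult_INR. simpl.
  assert (x * INR N <= 1 * INR N) by (apply Rmult_le_compat_r; lra). lra.
- replace (x - (INR i / INR N - 1)) with (((x + 1) * INR N - INR i) * / INR N) by (field; lra).
  rewrite Rabs_mult, (Rabs_right (/ INR N)).
  2:{ left. now apply Rinv_0_lt_compat. }
  rewrite <- (Rmult_1_l (/ INR N)) at 2. apply Rmult_le_compat_r.
  left; now apply Rinv_0_lt_compat. apply Rabs_le. lra.
Qed.

Lemma disc_net (d : R) : 0 < d -> exists ps : list C,
  forall z : C, Cmod z <= 1 -> exists p, In p ps /\ Cmod (z - p)%C <= d.
Proof.
intros Hd. destruct (archimed_cor1 (d / 2)) as [N [N1 N2]]. lra.
set (xs := map (fun i => INR i / INR N - 1) (seq 0 (2 * N + 1))).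
exists (list_prod xs xs). intros z Hz.
pose proof (Rabs_fst_le z) as X. pose proof (Rabs_snd_le z) as Y.
destruct (interval_net N (fst z) N2) as [i [I1 I2]]. { apply Rabs_le_between. lra. }
destruct (interval_net N (snd z) N2) as [j [J1 J2]]. { apply Rabs_le_between. lra. }
exists (INR i / INR N - 1, INR j / INR N - 1). split.
- apply in_prod; unfold xs; apply in_map_iff; [exists i | exists j];
  (split; [reflexivity|]); apply in_seq; lia.
- eapply Rle_trans; [apply Cmod_le_sum|]. simpl. unfold Rminus in *. lra.
Qed.

(** The weighted Cauchy estimate makes the family equi-Lipschitz, so it is enough to control a
    finite net: eps/4 to reach a net point, eps/2 there, eps/4 back. *)
Lemma montel_stage (a M r eps : R) (fs : nat -> C -> C) : 0 <= a -> 0 <= r < 1 -> 0 < eps ->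
  (forall n, holoD (fs n)) ->
  (forall n z, inD z -> weight a z * Cmod (fs n z) <= M) ->
  exists theta, increasing_nat theta /\ forall m n (z : C), Cmod z <= r ->
    Cmod (fs (theta m) z - fs (theta n) z)%C <= eps.
Proof.
intros Ha Hr Heps Hol HM.
(* The margin between [r] and [r1] allows the net point near [z] to lie slightly outside |z| <=
   r. *)
set (r1 := (1 + r) / 2). set (t := 1 - r1 ^ 2).
assert (Hr1 : r < r1 < 1) by (unfold r1; lra).
assert (Ht : 0 < t) by (unfold t; nra).
assert (Tw : forall z : C, Cmod z <= r1 -> 0 < t <= 1 - Cmod z ^ 2).
{ intros z Hz. split; auto. unfold t. pose proof (Cmod_ge_0 z). nra. }
assert (M0 : 0 <= M).
{ eapply Rle_trans; [|apply (HM O (RtoC 0))]. apply Rmult_le_pos.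
  left; apply weight_pos. apply Cmod_ge_0. apply inD_Cmod. rewrite Cmod_0; lra. }
set (B := M / Rpower t a). set (L := 8 * Rpower 4 a * M / Rpower t (a + 1)).
assert (HB : forall n (z : C), Cmod z <= r1 -> Cmod (fs n z) <= B).
{ intros n z Hz. apply Rle_div_r. apply exp_pos.
  pose proof (weight_ge a t z Ha (Tw z Hz)).
  specialize (HM n z ltac:(apply inD_Cmod; lra)). pose proof (Cmod_ge_0 (fs n z)). nra. }
assert (HL : forall n (z l : C), Cmod z <= r1 -> has_cderiv (fs n) z l -> Cmod l <= L).
{ intros n z l Hz Hl. apply Rle_div_r. apply exp_pos.
  pose proof (weight_ge (a + 1) t z ltac:(lra) (Tw z Hz)).
  pose proof (weighted_cauchy_estimate a M (fs n) z l Ha (Hol n) (HM n) ltac:(lra) Hl).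
  pose proof (Cmod_ge_0 l). nra. }
assert (L0 : 0 <= L).
{ apply Rdiv_le_0_compat; [|apply exp_pos]. repeat apply Rmult_le_pos; try lra. left; apply exp_pos. }
assert (Lip : forall n (z w : C), Cmod z <= r1 -> Cmod w <= r1 ->
  Cmod (fs n w - fs n z)%C <= L * Cmod (w - z)%C).
{ intros n z w Hz Hw.
  assert (Sg : forall s, 0 <= s <= 1 -> Cmod (z + RtoC s * (w - z))%C <= r1).
  { intros s Hs. replace (z + RtoC s * (w - z))%C with (RtoC (1 - s) * z + RtoC s * w)%C
      by (rewrite RtoC_minus; ring).
    eapply Rle_trans; [apply Cmod_triangle|].
    rewrite !Cmod_mult, !Cmod_R, !Rabs_right by lra. nra. }
  assert (D : forall v : C, Cmod v <= r1 -> has_cderiv (fs n) v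
     (epsilon (inhabits (RtoC 0)) (has_cderiv (fs n) v))).
  { intros v Hv. apply epsilon_spec. apply Hol. apply inD_Cmod. lra. }
  replace w with (z + (w - z))%C at 1 by ring.
  apply (lipschitz_segment (fs n) (fun v => epsilon (inhabits (RtoC 0)) (has_cderiv (fs n) v))).
  - intros s Hs. auto.
  - intros s Hs. apply (HL n (z + RtoC s * (w - z))%C); auto. }
set (eta := Rmin (r1 - r) (eps / (4 * (L + 1)))).
assert (Heta : 0 < eta).
{ apply Rmin_glb_lt. lra. apply Rdiv_lt_0_compat; lra. }
destruct (disc_net eta Heta) as [ps Hps].
destruct (pigeonhole_list fs (fun p => Cmod p <= r1) B (eps / 2) ps) as [th [T1 T2]]; auto. lra.
exists th. split; auto. intros m n z Hz.
destruct (Hps z ltac:(lra)) as [p [P1 P2]].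
assert (Hp : Cmod p <= r1).
{ pose proof (Cmod_triangle z (- (z - p))%C) as T. rewrite Cmod_opp in T.
  replace (z + - (z - p))%C with p in T by ring.
  pose proof (Rmin_l (r1 - r) (eps / (4 * (L + 1)))). fold eta in H. lra. }
assert (Near : forall k, Cmod (fs k z - fs k p)%C <= eps / 4).
{ intros k. eapply Rle_trans; [apply Lip; auto; lra|].
  pose proof (Rmin_r (r1 - r) (eps / (4 * (L + 1)))) as Q. fold eta in Q.
  assert (Q2 : Cmod (z - p)%C <= eps / (4 * (L + 1))) by lra.
  apply Rle_div_r in Q2; [|lra]. pose proof (Cmod_ge_0 (z - p)%C). nra. }
specialize (T2 p P1 Hp m n).
eapply Rle_trans; [apply (Cmod_sub_triangle _ (fs (th m) p))|].
eapply Rle_trans; [apply Rplus_le_compat_l, (Cmod_sub_triangle _ (fs (th n) p))|].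
rewrite (Cmod_sub_sym (fs (th n) p)).
pose proof (Near (th m)). pose proof (Near (th n)). lra.
Qed.

(** Stage [k] of the diagonal argument treats the radius 1 - 1/(k+1) with tolerance 1/(k+1). The
    Cauchy form suits the use made of it, on differences f_m - f_n. *)
Lemma montel (a M : R) (fs : nat -> C -> C) : 0 <= a ->
  (forall n, holoD (fs n)) ->
  (forall n z, inD z -> weight a z * Cmod (fs n z) <= M) ->
  exists phi, increasing_nat phi /\ forall r eps, r < 1 -> 0 < eps -> exists N,
    forall m n, (N <= m)%nat -> (N <= n)%nat -> forall z : C, Cmod z <= r ->
      Cmod (fs (phi m) z - fs (phi n) z)%C <= eps.
Proof.
intros Ha Hol HM.
assert (Iv : forall k, 0 < / (INR k + 1) <= 1).
{ intros k. pose proof (pos_INR k). split. apply Rinv_0_lt_compat; lra.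
  rewrite <- Rinv_1. apply Rinv_le_contravar; lra. }
destruct (diagonal (fun k m n => forall z : C, Cmod z <= 1 - / (INR k + 1) ->
   Cmod (fs m z - fs n z)%C <= / (INR k + 1))) as [phi [P1 P2]].
{ intros k psi Hpsi. specialize (Iv k).
  destruct (montel_stage a M (1 - / (INR k + 1)) (/ (INR k + 1)) (fun n => fs (psi n)))
    as [th [T1 T2]]; auto; try lra. exists th. split; auto. }
exists phi. split; auto. intros r eps Hr Heps.
destruct (archimed_cor1 (Rmin (1 - r) eps)) as [k [K1 K2]]. apply Rmin_glb_lt; lra.
assert (K3 : / (INR k + 1) <= / INR k).
{ apply Rinv_le_contravar. now apply lt_0_INR. lra. }
pose proof (Rmin_l (1 - r) eps). pose proof (Rmin_r (1 - r) eps).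
exists k. intros m n Hm Hn z Hz.
eapply Rle_trans. apply (P2 k m n Hm Hn z). lra. lra.
Qed.

(** Otherwise points with |g| > n would cluster inside the disc, against continuity at the cluster
    point. *)
Lemma bounded_on_compact (g : C -> C) (r : R) : holoD g -> r < 1 ->
  exists A, 0 <= A /\ forall z : C, Cmod z <= r -> Cmod (g z) <= A.
Proof.
intros Hg Hr. apply NNPP. intros H.
assert (K : forall n : nat, exists z : C, Cmod z <= r /\ INR n < Cmod (g z)).
{ intros n. apply NNPP. intros H1. apply H. exists (INR n). split. apply pos_INR.
  intros z Hz. apply Rnot_lt_le. intros L. apply H1. eauto. }
set (u := fun n => epsilon (inhabits (RtoC 0)) (fun z : C => Cmod z <= r /\ INR n < Cmod (g z))).
assert (Hu : forall n, Cmod (u n) <= r /\ INR n < Cmod (g (u n))).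
{ intros n. apply (epsilon_spec (inhabits (RtoC 0)) (fun z : C => Cmod z <= r /\ INR n < Cmod (g z))). auto. }
destruct (C_cluster u r) as [l Hl]. apply Hu.
assert (Ll : Cmod l <= r).
{ apply le_epsilon. intros e He. destruct (Hl e O He) as [p [_ Hp]].
  pose proof (Cmod_triangle (u p) (- (u p - l))%C) as T. rewrite Cmod_opp in T.
  replace (u p + - (u p - l))%C with l in T by ring. pose proof (proj1 (Hu p)). lra. }
destruct (Hg l) as [m Hm]. apply inD_Cmod; lra.
destruct (has_cderiv_cont g l m Hm 1 Rlt_0_1) as [d [Hd K1]].
destruct (nfloor_ex (Cmod (g l))) as [N [_ HN]]. apply Cmod_ge_0.
(* One successor rounds |g(l)| up, the other allows for the variation 1 near [l]. *)
destruct (Hl d (S (S N)) Hd) as [p [Hp1 Hp2]].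
specialize (K1 _ Hp2). replace (l + (u p - l))%C with (u p) in K1 by ring.
destruct (Hu p) as [_ H3].
pose proof (Cmod_triangle (g (u p) - g l)%C (g l)) as T.
replace (g (u p) - g l + g l)%C with (g (u p)) in T by ring.
assert (INR (S (S N)) <= INR p) by (apply le_INR; lia). rewrite !S_INR in H0. lra.
Qed.

(** * Sufficiency *)

Lemma IsSg_derivative (g f h : C -> C) : IsSg g f h ->
  exists df : C -> C, forall z : C, Cmod z < 1 ->
    has_cderiv f z (df z) /\ has_cderiv h z (df z * g z)%C.
Proof.
intros [_ H].
exists (fun z => epsilon (inhabits (RtoC 0)) (fun l => has_cderiv f z l /\ has_cderiv h z (Cmul l (g z)))).
intros z Hz.
apply (epsilon_spec (inhabits (RtoC 0)) (fun l => has_cderiv f z l /\ has_cderiv h z (Cmul l (g z)))).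
apply H. now apply inD_Cmod.
Qed.

Lemma IsSg_sub (g f1 h1 f2 h2 : C -> C) : IsSg g f1 h1 -> IsSg g f2 h2 ->
  IsSg g (fun z => f1 z - f2 z)%C (fun z => h1 z - h2 z)%C.
Proof.
intros [Z1 H1] [Z2 H2]. split.
- rewrite Z1, Z2. apply injective_projections; simpl; ring.
- intros z Hz. destruct (H1 z Hz) as [l1 [A1 B1]]. destruct (H2 z Hz) as [l2 [A2 B2]].
  exists (l1 - l2)%C. split. now apply has_cderiv_sub.
  change (has_cderiv (fun z => h1 z - h2 z)%C z ((l1 - l2) * g z)%C).
  replace ((l1 - l2) * g z)%C with (l1 * g z - l2 * g z)%C by ring.
  now apply has_cderiv_sub.
Qed.

Lemma IsSg_holo (g f h : C -> C) : IsSg g f h -> holoD f /\ holoD h.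
Proof.
intros [_ H]; split; intros z Hz; destruct (H z Hz) as [l [H1 H2]]; eexists; eauto.
Qed.

Lemma weight_bound_nonneg (a M : R) (f : C -> C) :
  (forall z, inD z -> weight a z * Cmod (f z) <= M) -> 0 <= M.
Proof.
intros H. eapply Rle_trans; [|apply (H (RtoC 0))].
- apply Rmult_le_pos. left; apply weight_pos. apply Cmod_ge_0.
- apply inD_Cmod. rewrite Cmod_0. lra.
Qed.

(** The estimate behind both boundedness and compactness. Near the circle (b + 1) = (a + 1) + (b -
    a) pairs the Cauchy bound for f' with the smallness of g; on |z| <= r the bound [A] is left to
    the caller, who has different reasons for it in the two uses. *)
Lemma Sg_bound (a b M r A eps : R) (g f h : C -> C) : 0 <= a -> 0 < b -> 0 <= A -> 0 <= eps ->
  IsSg g f h -> (forall z, inD z -> weight a z * Cmod (f z) <= M) ->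
  (forall z : C, r < Cmod z < 1 -> weight (b - a) z * Cmod (g z) <= eps) ->
  (forall z l : C, Cmod z < 1 -> Cmod z <= r -> has_cderiv f z l -> Cmod l * Cmod (g z) <= A) ->
  forall z : C, Cmod z < 1 ->
    weight b z * Cmod (h z) <= A + 8 * Rpower 4 a * M * eps * (Rpower 2 b / b).
Proof.
intros Ha Hb HA Heps HS HM Hg Hf.
pose proof (weight_bound_nonneg a M f HM) as M0.
destruct (IsSg_holo g f h HS) as [Hol _].
destruct (IsSg_derivative g f h HS) as [df Hdf].
assert (P : 0 <= 8 * Rpower 4 a * M).
{ repeat apply Rmult_le_pos; auto; try lra. left; apply exp_pos. }
apply (weighted_primitive_bound b r A (8 * Rpower 4 a * M * eps) h (fun z => df z * g z)%C); auto.
- now apply Rmult_le_pos.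
- intros z Hz. now apply Hdf.
- apply HS.
- intros z Hz Hr. rewrite Cmod_mult. apply Hf; auto. now apply Hdf.
- intros z Hz. rewrite Cmod_mult.
  replace (b + 1) with ((a + 1) + (b - a)) by ring. rewrite weight_plus.
  pose proof (weighted_cauchy_estimate a M f z (df z) Ha Hol HM (proj2 Hz) (proj1 (Hdf z (proj2 Hz)))) as K.
  specialize (Hg z Hz).
  replace (weight (a + 1) z * weight (b - a) z * (Cmod (df z) * Cmod (g z))) with
    ((weight (a + 1) z * Cmod (df z)) * (weight (b - a) z * Cmod (g z))) by ring.
  apply Rmult_le_compat; auto; apply Rmult_le_pos; try apply Cmod_ge_0; left; apply weight_pos.
Qed.

Lemma derivative_bound_compact (a M r : R) (f : C -> C) (z l : C) : 0 <= a -> holoD f ->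
  (forall z, inD z -> weight a z * Cmod (f z) <= M) -> Cmod z <= r -> r < 1 ->
  has_cderiv f z l -> Cmod l <= 8 * Rpower 4 a * M / Rpower (1 - r ^ 2) (a + 1).
Proof.
intros Ha Hol HM Hz Hr Hl. pose proof (Cmod_ge_0 z).
apply Rle_div_r. apply exp_pos.
pose proof (weighted_cauchy_estimate a M f z l Ha Hol HM ltac:(lra) Hl).
assert (Rpower (1 - r ^ 2) (a + 1) <= weight (a + 1) z) by (apply weight_ge; [lra|split; nra]).
pose proof (Cmod_ge_0 l). nra.
Qed.

Lemma Sg_bounded_of_lim (a b : R) (g f h : C -> C) : holoD g -> 0 <= a -> 0 < b ->
  weighted_lim0 g a b -> in_Hinf a f -> IsSg g f h -> in_Hinf b h.
Proof.
intros Hg Ha Hb Hlim [Hol [M HM]] HS.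
assert (HM' : forall z : C, inD z -> weight a z * Cmod (f z) <= M)
  by (intros z Hz; rewrite <- Cmod_Complex; auto).
split. apply (IsSg_holo g f h HS).
destruct (Hlim 1 Rlt_0_1) as [r [Hr1 Hr]].
destruct (bounded_on_compact g r Hg Hr1) as [A [A0 HA]].
pose proof (weight_bound_nonneg a M f HM') as M0.
set (L := 8 * Rpower 4 a * M / Rpower (1 - r ^ 2) (a + 1)).
assert (L0 : 0 <= L).
{ apply Rdiv_le_0_compat; [|apply exp_pos]. repeat apply Rmult_le_pos; try lra. left; apply exp_pos. }
exists (L * A + 8 * Rpower 4 a * M * 1 * (Rpower 2 b / b)).
intros z Hz. rewrite Cmod_Complex.
apply (Sg_bound a b M r (L * A) 1 g f h); auto; try lra.
- now apply Rmult_le_pos.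
- intros w Hw. left. rewrite <- Cmod_Complex. apply Hr. now rewrite Cmod_Complex.
- intros w l Hw1 Hw2 Hl. apply Rmult_le_compat; try apply Cmod_ge_0; auto.
  apply (derivative_bound_compact a M r f w l); auto.
- now apply inD_Cmod.
Qed.

Lemma Sg_compact_of_lim (a b : R) (g : C -> C) : holoD g -> 0 <= a -> 0 < b ->
  weighted_lim0 g a b -> Sg_compact g a b.
Proof.
intros Hg Ha Hb Hlim. split.
{ intros f h. now apply Sg_bounded_of_lim. }
intros fs hs M Hol HM0 HS.
assert (HM : forall n (z : C), inD z -> weight a z * Cmod (fs n z) <= M)
  by (intros n z Hz; rewrite <- Cmod_Complex; apply HM0; auto).
pose proof (weight_bound_nonneg a M (fs O) (HM O)) as M0.
destruct (montel a M fs Ha Hol HM) as [phi [P1 P2]].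
assert (Hb0 : 0 <= b) by lra.
assert (Hh : forall n, holoD (hs n)) by (intros n; apply (IsSg_holo g (fs n)); auto).
assert (Cy : forall eps, 0 < eps -> exists N, forall m n, (N <= m)%nat -> (N <= n)%nat ->
  forall z : C, Cmod z < 1 -> weight b z * Cmod (hs (phi m) z - hs (phi n) z)%C <= eps).
{ intros eps Heps.
  set (K := 8 * Rpower 4 a * (2 * M) * (Rpower 2 b / b)).
  assert (K0 : 0 <= K).
  { apply Rmult_le_pos. repeat apply Rmult_le_pos; try lra. left; apply exp_pos.
    apply Rdiv_le_0_compat; auto. left; apply exp_pos. }
  set (e1 := eps / (2 * (K + 1))).
  assert (He1 : 0 < e1) by (apply Rdiv_lt_0_compat; lra).
  assert (HK : K * e1 <= eps / 2).
  { unfold e1. replace (K * (eps / (2 * (K + 1)))) with (eps / 2 * (K / (K + 1))) by (field; lra).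
    rewrite <- (Rmult_1_r (eps / 2)) at 2. apply Rmult_le_compat_l. lra.
    apply Rle_div_l; lra. }
  destruct (Hlim e1 He1) as [r [Hr1 Hr]].
  destruct (bounded_on_compact g r Hg Hr1) as [A [A0 HA]].
  (* The Cauchy estimate with radius (1 - r)/2 turns [d] into the bound eps / (2 (A + 1)) for (f_m -
     f_n)' on |w| <= r, hence eps/2 after multiplication by [g]. The discs used fill up |w| <= (1 +
     r)/2. *)
  set (d := eps * (1 - r) / (8 * (A + 1))).
  assert (Hd : 0 < d) by (apply Rdiv_lt_0_compat; [apply Rmult_lt_0_compat|]; lra).
  destruct (P2 ((1 + r) / 2) d) as [N HN]; auto. lra.
  exists N. intros m n Hm Hn z Hz. specialize (HN m n Hm Hn).
  eapply Rle_trans.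
  { apply (Sg_bound a b (2 * M) r (eps / 2) e1 g (fun z => fs (phi m) z - fs (phi n) z)%C
      (fun z => hs (phi m) z - hs (phi n) z)%C); auto; try lra.
    - now apply IsSg_sub.
    - intros w Hw.
      pose proof (HM (phi m) w Hw). pose proof (HM (phi n) w Hw).
      pose proof (Cmod_triangle (fs (phi m) w) (- fs (phi n) w)%C) as T.
      rewrite Cmod_opp in T. pose proof (weight_pos a w).
      change (weight a w * Cmod (fs (phi m) w + - fs (phi n) w)%C <= 2 * M). nra.
    - intros w Hw. left. rewrite <- Cmod_Complex. apply Hr. now rewrite Cmod_Complex.
    - intros w l Hw1 Hw2 Hl.
      assert (Q : Cmod l <= 2 * d / ((1 - r) / 2)).
      { apply (cauchy_estimate (fun z => fs (phi m) z - fs (phi n) z)%C w l _ (1 - r)); auto.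
        - lra.
        - intros v Hv. apply holoD_sub; auto. apply inD_Cmod.
          pose proof (Cmod_triangle w v). lra.
        - intros v Hv. apply HN. pose proof (Cmod_triangle w v). lra. }
      assert (Q2 : 2 * d / ((1 - r) / 2) = eps / (2 * (A + 1))) by (unfold d; field; lra).
      rewrite Q2 in Q. apply Rle_div_r in Q; [|lra].
      specialize (HA w Hw2). pose proof (Cmod_ge_0 l). pose proof (Cmod_ge_0 (g w)). nra. }
  change (eps / 2 + 8 * Rpower 4 a * (2 * M) * e1 * (Rpower 2 b / b) <= eps).
  replace (8 * Rpower 4 a * (2 * M) * e1 * (Rpower 2 b / b)) with (K * e1) by (unfold K; ring).
  lra. }
set (lim := fun (z l : C) => forall eps, 0 < eps -> exists N, forall n, (N <= n)%nat ->
  Cmod (hs (phi n) z - l)%C <= eps).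
set (h := fun z => epsilon (inhabits (RtoC 0)) (lim z)).
assert (Hl : forall z : C, Cmod z < 1 -> lim z (h z)).
{ intros z Hz. apply epsilon_spec. apply C_complete.
  intros eps Heps. pose proof (weight_pos b z) as W.
  destruct (Cy (weight b z * eps)) as [N HN]. now apply Rmult_lt_0_compat.
  exists N. intros m n Hm Hn. apply Rmult_le_reg_l with (weight b z); auto. }
(* The second index goes to infinity pointwise, with slack [e]; [N] stays independent of [z]. *)
assert (U : forall eps, 0 < eps -> exists N, forall n, (N <= n)%nat -> forall z : C, inD z ->
     weight b z * Cmod (hs (phi n) z - h z)%C <= eps).
{ intros eps Heps. destruct (Cy eps Heps) as [N HN]. exists N. intros n Hn z Hz.
  apply inD_Cmod in Hz. pose proof (weight_pos b z) as W.
  apply le_epsilon. intros e He.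
  destruct (Hl z Hz (e / weight b z)) as [N2 HN2]. now apply Rdiv_lt_0_compat.
  set (m := max N N2).
  specialize (HN n m Hn ltac:(lia) z Hz). specialize (HN2 m ltac:(lia)).
  apply Rle_div_r in HN2; auto.
  pose proof (Cmod_sub_triangle (hs (phi n) z) (hs (phi m) z) (h z)). nra. }
assert (Hh_lim : holoD h).
{ apply (weierstrass b (fun n => hs (phi n))); auto. }
exists phi, h. split; [|split].
- exact P1.
- split; auto. destruct (U 1 Rlt_0_1) as [N HN].
  assert (HB : in_Hinf b (hs (phi N))).
  { apply (Sg_bounded_of_lim a b g (fs (phi N))); auto. split; auto. exists M. intros z Hz.
    apply HM0; auto. }
  destruct HB as [_ [B HB]]. exists (B + 1). intros z Hz. specialize (HB z Hz).
  rewrite Cmod_Complex in *. specialize (HN N (Nat.le_refl N) z Hz).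
  rewrite Cmod_sub_sym in HN.
  pose proof (Cmod_triangle (h z - hs (phi N) z)%C (hs (phi N) z)) as T.
  replace (h z - hs (phi N) z + hs (phi N) z)%C with (h z) in T by ring.
  pose proof (weight_pos b z). nra.
- intros eps Heps. destruct (U eps Heps) as [N HN]. exists N. intros n Hn z Hz.
  rewrite Cmod_Complex. exact (HN n Hn z Hz).
Qed.

(** Every image has derivative zero and vanishes at 0, so it is zero on the disc. This covers
    [b = 0], where the radial integration does not apply. *)
Lemma Sg_compact_zero (a b : R) (g : C -> C) : 0 <= b ->
  (forall z : C, inD z -> g z = C0) -> Sg_compact g a b.
Proof.
intros Hb Hg.
assert (Z : forall f h, IsSg g f h -> forall z : C, inD z -> h z = RtoC 0).
{ intros f h HS z Hz. apply inD_Cmod in Hz.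
  destruct (IsSg_derivative g f h HS) as [df Hdf].
  assert (Hin : forall t, 0 <= t <= 1 -> Cmod (0 + RtoC t * z)%C < 1).
  { intros t Ht. rewrite Cplus_0_l, Cmod_mult, Cmod_R, Rabs_right by lra.
    pose proof (Cmod_ge_0 z). nra. }
  pose proof (lipschitz_segment h (fun z => df z * g z)%C (RtoC 0) z 0) as L.
  rewrite Cplus_0_l, Rmult_0_l in L.
  destruct HS as [H0 _]. change (h (RtoC 0) = RtoC 0) in H0.
  replace (h z) with (h z - h (RtoC 0))%C by (rewrite H0; ring).
  apply Cmod_eq_0. apply Rle_antisym; [|apply Cmod_ge_0]. apply L.
  - intros t Ht. apply Hdf. auto.
  - intros t Ht. rewrite Hg by (apply inD_Cmod; auto).
    change C0 with (RtoC 0). rewrite Cmult_0_r, Cmod_0. lra. }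
assert (W : forall z : C, weight b z * Cmod (RtoC 0) <= 0) by (intros; rewrite Cmod_0; lra).
split.
- intros f h _ HS. split. now apply (IsSg_holo g f).
  exists 0. intros z Hz. rewrite Cmod_Complex, (Z f h HS z Hz). apply W.
- intros fs hs M _ _ HS. exists (fun n => n), (fun _ => RtoC 0). split; [|split].
  + intros; lia.
  + split. intros z Hz. exists (RtoC 0). apply has_cderiv_const.
    exists 0. intros z Hz. rewrite Cmod_Complex. apply W.
  + intros eps Heps. exists O. intros n _ z Hz.
    rewrite (Z (fs n) (hs n) (HS n) z Hz), Cmod_Complex.
    replace (Csub (RtoC 0) (RtoC 0)) with (RtoC 0).
    eapply Rle_trans; [apply W | lra].
    apply injective_projections; simpl; ring.
Qed.

(** * Necessity: the test functions n^a z^n *)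

Lemma has_cderiv_pow (n : nat) (z : C) :
  has_cderiv (fun w => w ^ S n)%C z (RtoC (INR (S n)) * z ^ n)%C.
Proof.
induction n as [|n IH].
- simpl. replace (1 * 1)%C with (1 * 1 - 0)%C by ring.
  eapply has_cderiv_ext_loc with (f := fun w => (w - 0)%C) (r := 1). lra.
  intros; ring. replace (1 * 1 - 0)%C with (1 - 0)%C by ring.
  apply (has_cderiv_sub (fun w => w) (fun _ => RtoC 0)). apply has_cderiv_id. apply has_cderiv_const.
- replace (RtoC (INR (S (S n))) * z ^ S n)%C with
    (1 * z ^ S n + z * (RtoC (INR (S n)) * z ^ n))%C.
  apply (has_cderiv_mul (fun w => w) (fun w => w ^ S n)%C); auto. apply has_cderiv_id.
  rewrite (S_INR (S n)), RtoC_plus. simpl. ring.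
Qed.

(** With u = x / (a + 1), ln u < u gives a ln u <= (a + 1) u = x. Dividing by a + 1 instead of a
    includes a = 0. *)
Lemma Rpower_le_exp (x a : R) : 0 < x -> 0 <= a -> Rpower x a <= exp x * Rpower (a + 1) a.
Proof.
intros Hx Ha. unfold Rpower. rewrite <- exp_plus.
assert (H : a * ln x <= x + a * ln (a + 1)).
{ assert (E : ln x = ln (x / (a + 1)) + ln (a + 1)).
  { rewrite <- ln_mult. f_equal. field. lra. apply Rdiv_lt_0_compat; lra. lra. }
  set (u := x / (a + 1)) in *.
  assert (Hu : 0 < u) by (apply Rdiv_lt_0_compat; lra).
  assert (Hx' : x = u * (a + 1)) by (unfold u; field; lra).
  assert (ln u < u).
  { rewrite <- (ln_exp u) at 2. apply ln_increasing; auto. pose proof (exp_ineq1 u ltac:(lra)). lra. }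
  rewrite E. nra. }
destruct H as [H|H]. left; now apply exp_increasing. rewrite H; lra.
Qed.

Lemma pow_le_exp (r : R) (n : nat) : 0 <= r -> r ^ n <= exp (- (INR n * (1 - r))).
Proof.
intros Hr. induction n as [|n IH].
- simpl. rewrite Rmult_0_l, Ropp_0, exp_0. lra.
- rewrite S_INR. replace (- ((INR n + 1) * (1 - r))) with (- (1 - r) + - (INR n * (1 - r))) by ring.
  rewrite exp_plus. simpl. apply Rmult_le_compat; auto. now apply pow_le.
  pose proof (exp_ineq1_le (- (1 - r))). lra.
Qed.

Lemma bernoulli_le (s : R) (n : nat) : 0 <= s <= 1 -> 1 - INR n * s <= (1 - s) ^ n.
Proof.
intros Hs. induction n as [|n IH]. simpl; lra.
rewrite S_INR. simpl. pose proof (pos_INR n). nra.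
Qed.

(** The exponent is [S n], which keeps the base of [Rpower] positive and makes the derivative a
    multiple of z^n. *)
Definition test_fun (a : R) (n : nat) (z : C) : C :=
  (RtoC (Rpower (INR (S n)) a) * z ^ S n)%C.

Definition test_der (a : R) (n : nat) (z : C) : C :=
  (RtoC (Rpower (INR (S n)) a) * (RtoC (INR (S n)) * z ^ n))%C.

Lemma INR_S_pos (n : nat) : 0 < INR (S n).
Proof. apply lt_0_INR. lia. Qed.

Lemma test_fun_der (a : R) (n : nat) (z : C) : has_cderiv (test_fun a n) z (test_der a n z).
Proof. apply (has_cderiv_scal _ (fun w => w ^ S n)%C). apply has_cderiv_pow. Qed.

Lemma Cmod_test_der (a : R) (n : nat) (z : C) :
  Cmod (test_der a n z) = Rpower (INR (S n)) (a + 1) * Cmod z ^ n.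
Proof.
unfold test_der. pose proof (INR_S_pos n).
rewrite !Cmod_mult, !Cmod_R, Cmod_pow, Rpower_plus, Rpower_1 by auto.
rewrite !Rabs_right. ring. lra. left; apply exp_pos.
Qed.

Lemma test_der_holo (a : R) (n : nat) (z : C) : exists l, has_cderiv (test_der a n) z l.
Proof.
destruct n as [|n].
- exists (RtoC (Rpower (INR 1) a) * (RtoC (INR 1) * 0))%C.
  apply (has_cderiv_scal _ (fun w => RtoC (INR 1) * w ^ 0)%C).
  apply (has_cderiv_scal _ (fun w => w ^ 0)%C). simpl. apply has_cderiv_const.
- eexists. apply (has_cderiv_scal _ (fun w => RtoC (INR (S (S n))) * w ^ S n)%C).
  apply (has_cderiv_scal _ (fun w => w ^ S n)%C). apply has_cderiv_pow.
Qed.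

Lemma test_fun_bound (a : R) (n : nat) (z : C) : 0 <= a -> Cmod z < 1 ->
  weight a z * Cmod (test_fun a n z) <= Rpower 2 a * Rpower (a + 1) a.
Proof.
intros Ha Hz. pose proof (INR_S_pos n) as Hn. pose proof (Cmod_ge_0 z) as Z0.
(* In the variable [x] the weighted modulus is at most 2^a x^a e^(-x), whatever [n] is. *)
set (r := Cmod z) in *. set (x := INR (S n) * (1 - r)).
assert (Hx : 0 < x) by (apply Rmult_lt_0_compat; lra).
unfold test_fun. rewrite Cmod_mult, Cmod_R, Rabs_right, Cmod_pow by (left; apply exp_pos).
fold r.
apply Rle_trans with (Rpower (2 * (1 - r)) a * (Rpower (INR (S n)) a * exp (- x))).
- apply Rmult_le_compat.
  + left; apply weight_pos.
  + apply Rmult_le_pos. left; apply exp_pos. now apply pow_le.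
  + apply weight_le; auto. fold r. nra.
  + apply Rmult_le_compat_l. left; apply exp_pos. now apply pow_le_exp.
- rewrite <- Rmult_assoc, Rpower_mult_distr by lra.
  replace (2 * (1 - r) * INR (S n)) with (2 * x) by (unfold x; ring).
  rewrite <- Rpower_mult_distr by lra.
  rewrite Rmult_assoc. apply Rmult_le_compat_l. left; apply exp_pos.
  rewrite exp_Ropp. apply Rle_div_l. apply exp_pos. rewrite Rmult_comm. now apply Rpower_le_exp.
Qed.

Lemma test_der_small (a r : R) : 0 <= a -> 0 <= r < 1 -> exists K, 0 <= K /\
  forall n (z : C), Cmod z <= r -> Cmod (test_der a n z) <= K / INR (S n).
Proof.
intros Ha Hr. set (s := 1 - r). assert (Hs : 0 < s <= 1) by (unfold s; lra).
(* The derivative grows like (n+1)^(a+1) times an exponentially small factor; comparison with the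
   power a + 2 leaves 1/(n+1). The factor [exp 1] makes up for z^n in place of z^(n+1). *)
exists (exp 1 * Rpower (a + 3) (a + 2) / Rpower s (a + 2)). split.
{ apply Rdiv_le_0_compat; [|apply exp_pos]. apply Rmult_le_pos; left; apply exp_pos. }
intros n z Hz. pose proof (INR_S_pos n) as Hn. set (N := INR (S n)) in *.
assert (Hx : 0 < N * s) by (apply Rmult_lt_0_compat; lra).
pose proof (Rpower_le_exp (N * s) (a + 2) Hx ltac:(lra)) as Q.
replace (a + 2 + 1) with (a + 3) in Q by ring.
rewrite <- Rpower_mult_distr in Q by lra.
rewrite Cmod_test_der. fold N.
assert (P : Cmod z ^ n <= exp 1 * exp (- (N * s))).
{ apply Rle_trans with (r ^ n). apply pow_incr. split; auto. apply Cmod_ge_0.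
  eapply Rle_trans. apply pow_le_exp; lra. rewrite <- exp_plus.
  assert (- (INR n * (1 - r)) <= 1 + - (N * s)).
  { unfold N. rewrite S_INR. fold s. lra. }
  destruct H as [H|H]. left; now apply exp_increasing. rewrite H; lra. }
apply -> Rle_div_r; auto.
replace (Rpower N (a + 1) * Cmod z ^ n * N) with (Rpower N (a + 2) * Cmod z ^ n).
2:{ replace (a + 2) with (a + 1 + 1) by ring. rewrite (Rpower_plus (a + 1) 1 N), (Rpower_1 N) by auto. ring. }
apply -> Rle_div_r; [|apply exp_pos].
apply Rle_trans with (Rpower N (a + 2) * (exp 1 * exp (- (N * s))) * Rpower s (a + 2)).
{ apply Rmult_le_compat_r. left; apply exp_pos. apply Rmult_le_compat_l; auto. left; apply exp_pos. }
replace (Rpower N (a + 2) * (exp 1 * exp (- (N * s))) * Rpower s (a + 2)) with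
 (exp 1 * (Rpower N (a + 2) * Rpower s (a + 2) * exp (- (N * s)))) by ring.
apply Rmult_le_compat_l. left; apply exp_pos.
rewrite exp_Ropp. apply Rle_div_l. apply exp_pos. lra.
Qed.

(* The exponent [n + 1 ~ 1 / (2 (1 - |z|))] makes the derivative of [(n+1)^a z^(n+1)] as large
   as the Cauchy estimate permits. *)
Lemma test_der_large (a : R) (z : C) : 0 <= a -> 1 / 2 <= Cmod z < 1 ->
  exists n, / (2 * (1 - Cmod z)) < INR (S n) /\
    Rpower (1 / 2) (a + 1) / 2 <= weight (a + 1) z * Cmod (test_der a n z).
Proof.
intros Ha Hz. set (s := 1 - Cmod z). assert (Hs : 0 < s <= 1 / 2) by (unfold s; lra).
(* n <= 1/(2s) gives |z|^n >= 1/2 by Bernoulli's inequality, and n + 1 > 1/(2s) bounds the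
   coefficient from below. *)
destruct (nfloor_ex (/ (2 * s))) as [n [N1 N2]].
{ left. apply Rinv_0_lt_compat. lra. }
exists n. rewrite S_INR. split. exact N2.
rewrite Cmod_test_der, S_INR.
assert (B : 1 / 2 <= Cmod z ^ n).
{ pose proof (bernoulli_le s n ltac:(lra)) as Q. replace (1 - s) with (Cmod z) in Q by (unfold s; ring).
  assert (INR n * s <= 1 / 2); [|lra].
  replace (1 / 2) with (/ (2 * s) * s) by (field; lra). apply Rmult_le_compat_r; lra. }
assert (W : Rpower s (a + 1) <= weight (a + 1) z).
{ apply weight_ge. lra. split. lra. unfold s. nra. }
assert (V : Rpower (/ (2 * s)) (a + 1) <= Rpower (INR n + 1) (a + 1)).
{ apply Rle_Rpower_l. lra. split. apply Rinv_0_lt_compat; lra. lra. }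
assert (E : Rpower s (a + 1) * Rpower (/ (2 * s)) (a + 1) = Rpower (1 / 2) (a + 1)).
{ rewrite Rpower_mult_distr. f_equal. field; lra. lra. apply Rinv_0_lt_compat; lra. }
assert (P1 : 0 < Rpower s (a + 1)) by apply exp_pos.
assert (P2 : 0 < Rpower (/ (2 * s)) (a + 1)) by apply exp_pos.
rewrite <- Rmult_assoc. unfold Rdiv at 1. rewrite <- E.
apply Rmult_le_compat; try lra. apply Rmult_le_pos; lra.
apply Rmult_le_compat; lra.
Qed.

Lemma IsSg_test (a : R) (g : C -> C) (n : nat) : holoD g ->
  exists h, IsSg g (test_fun a n) h /\
    forall z : C, Cmod z < 1 -> has_cderiv h z (test_der a n z * g z)%C.
Proof.
intros Hg. destruct (disc_primitive (fun z => test_der a n z * g z)%C) as [h [H0 H1]].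
{ intros z Hz. destruct (test_der_holo a n z) as [l Hl]. destruct (Hg z Hz) as [m Hm].
  eexists. apply has_cderiv_mul; eauto. }
exists h. split; [split; auto|].
- intros z Hz. exists (test_der a n z). split. apply test_fun_der. now apply H1.
- intros z Hz. apply H1. now apply inD_Cmod.
Qed.

(** If the limit fails, there are points approaching the circle where the weighted g stays above
    [eps], each with a test function whose derivative is large exactly there. The images converge to
    0 along a subsequence, which contradicts the Cauchy estimate at those points. *)
Lemma lim_of_Sg_compact (a b : R) (g : C -> C) : holoD g -> 0 <= a -> 0 <= b ->
  Sg_compact g a b -> weighted_lim0 g a b.
Proof.
intros Hg Ha Hb [_ Hc] eps Heps. apply NNPP. intros Hn.
(* At this distance from the circle the exponent supplied by [test_der_large] exceeds [k], so the
   chosen exponents tend to infinity. *)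
assert (Bad : forall k : nat, exists z : C, 1 - / (2 * (INR k + 1)) < Cmod z < 1 /\
   eps <= weight (b - a) z * Cmod (g z)).
{ intros k. apply NNPP. intros H. apply Hn. exists (1 - / (2 * (INR k + 1))). split.
  - assert (0 < / (2 * (INR k + 1))). { apply Rinv_0_lt_compat. pose proof (pos_INR k). lra. } lra.
  - intros z Hz. rewrite Cmod_Complex in *. apply Rnot_le_lt. intros L. apply H. eauto. }
assert (Pick : forall k : nat, exists p : C * nat, Cmod (fst p) < 1 /\ (k < snd p)%nat /\
   eps <= weight (b - a) (fst p) * Cmod (g (fst p)) /\
   Rpower (1 / 2) (a + 1) / 2 <= weight (a + 1) (fst p) * Cmod (test_der a (snd p) (fst p))).
{ intros k. destruct (Bad k) as [z [[Z1 Z2] Z3]].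
  pose proof (pos_INR k) as K0.
  assert (I1 : / (2 * (INR k + 1)) <= / 2) by (apply Rinv_le_contravar; lra).
  destruct (test_der_large a z Ha ltac:(lra)) as [n [N1 N2]].
  exists (z, n). cbn [fst snd]. repeat split; auto.
  assert (L : INR k + 1 < INR (S n)).
  { eapply Rle_lt_trans; [|apply N1].
    rewrite <- (Rinv_inv (INR k + 1)). apply Rinv_le_contravar. lra.
    rewrite Rinv_mult in Z1. lra. }
  rewrite <- S_INR in L. apply INR_lt in L. lia. }
apply (choice (fun k p => Cmod (fst p) < 1 /\ (k < snd p)%nat /\
   eps <= weight (b - a) (fst p) * Cmod (g (fst p)) /\
   Rpower (1 / 2) (a + 1) / 2 <= weight (a + 1) (fst p) * Cmod (test_der a (snd p) (fst p)))) in Pick.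
destruct Pick as [p Hp].
assert (Hhs : exists hs : nat -> C -> C, forall k, IsSg g (test_fun a (snd (p k))) (hs k) /\
    forall z : C, Cmod z < 1 -> has_cderiv (hs k) z (test_der a (snd (p k)) z * g z)%C).
{ apply (choice (fun k h => IsSg g (test_fun a (snd (p k))) h /\
    forall z : C, Cmod z < 1 -> has_cderiv h z (test_der a (snd (p k)) z * g z)%C)).
  intros k. now apply IsSg_test. }
destruct Hhs as [hs Hhs].
destruct (Hc (fun k => test_fun a (snd (p k))) hs (Rpower 2 a * Rpower (a + 1) a))
  as [phi [h [P1 [_ P2]]]].
{ intros k z _. eexists. apply test_fun_der. }
{ intros k z Hz. rewrite Cmod_Complex. apply test_fun_bound; auto. now apply inD_Cmod. }
{ intros k. apply Hhs. }
change (C -> C) in (type of h).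
assert (P3 : forall e, 0 < e -> exists N, forall n, (N <= n)%nat -> forall z : C, Cmod z < 1 ->
   weight b z * Cmod (hs (phi n) z - h z)%C <= e).
{ intros e He. destruct (P2 e He) as [N HN]. exists N. intros n Hn' z Hz.
  specialize (HN n Hn' z (proj2 (inD_Cmod z) Hz)). now rewrite Cmod_Complex in HN. }
(* Norm convergence forces pointwise convergence to the same limit, and pointwise the images are at
   most K A / (m + 1), since the test derivatives decay on |w| <= |z| where [g] is bounded. *)
assert (H0 : forall z : C, Cmod z < 1 -> h z = RtoC 0).
{ intros z Hz. pose proof (Cmod_ge_0 z) as Z0.
  apply Cmod_eq_0. apply Rle_antisym; [|apply Cmod_ge_0].
  apply le_epsilon. intros e He. rewrite Rplus_0_l.
  destruct (test_der_small a (Cmod z) Ha (conj Z0 Hz)) as [K [K0 HK]].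
  destruct (bounded_on_compact g (Cmod z) Hg Hz) as [A [A0 HA]].
  pose proof (weight_pos b z) as W.
  destruct (P3 (e / 2 * weight b z)) as [N HN]. apply Rmult_lt_0_compat; lra.
  destruct (archimed_cor1 (e / (2 * (K * A + 1)))) as [N2 [M1 M2]].
  { assert (0 <= K * A) by (now apply Rmult_le_pos). apply Rdiv_lt_0_compat; lra. }
  set (n := max N N2). specialize (HN n ltac:(lia) z Hz).
  assert (Q1 : Cmod (hs (phi n) z - h z)%C <= e / 2) by (apply Rmult_le_reg_l with (weight b z); lra).
  set (m := snd (p (phi n))).
  assert (Hm : INR N2 <= INR (S m)).
  { apply le_INR. pose proof (increasing_nat_ge phi P1 n). destruct (Hp (phi n)) as (_ & H2 & _).
    unfold m. lia. }
  assert (N2p : 0 < INR N2) by (now apply lt_0_INR).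
  assert (Q2 : Cmod (hs (phi n) z) <= e / 2).
  { destruct (Hhs (phi n)) as [[E0 _] Hd]. change (hs (phi n) (RtoC 0) = RtoC 0) in E0.
    assert (L : Cmod (hs (phi n) (0 + z) - hs (phi n) 0)%C <= K / INR (S m) * A * Cmod z).
    { assert (Hin : forall t, 0 <= t <= 1 -> Cmod (0 + RtoC t * z)%C <= Cmod z).
      { intros t Ht. rewrite Cplus_0_l, Cmod_mult, Cmod_R, Rabs_right by lra. nra. }
      apply (lipschitz_segment (hs (phi n)) (fun z => test_der a m z * g z)%C).
      - intros t Ht. apply Hd. specialize (Hin t Ht). lra.
      - intros t Ht. rewrite Cmod_mult. apply Rmult_le_compat; try apply Cmod_ge_0; auto. }
    rewrite Cplus_0_l, E0 in L. replace (hs (phi n) z - 0)%C with (hs (phi n) z) in L by ring.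
    eapply Rle_trans; [apply L|].
    assert (KA : 0 <= K * A) by (now apply Rmult_le_pos).
    assert (I2 : / INR (S m) <= / INR N2) by (now apply Rinv_le_contravar).
    assert (I0 : 0 < / INR (S m)) by (apply Rinv_0_lt_compat, INR_S_pos).
    apply Rle_trans with (K * A * / INR N2).
    { replace (K / INR (S m) * A * Cmod z) with (K * A * (/ INR (S m) * Cmod z)) by (unfold Rdiv; ring).
      apply Rmult_le_compat_l; auto. nra. }
    apply Rlt_le in M1. apply Rle_div_r in M1; [|lra].
    assert (0 < / INR N2) by (now apply Rinv_0_lt_compat). nra. }
  pose proof (Cmod_triangle (hs (phi n) z) (- (hs (phi n) z - h z))%C) as T.
  rewrite Cmod_opp in T. replace (hs (phi n) z + - (hs (phi n) z - h z))%C with (h z) in T by ring.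
  lra. }
set (c := Rpower (1 / 2) (a + 1) / 2).
assert (Hcp : 0 < c) by (apply Rdiv_lt_0_compat; [apply exp_pos | lra]).
set (R4 := 8 * Rpower 4 b). assert (R4p : 0 < R4) by (apply Rmult_lt_0_compat; [lra | apply exp_pos]).
(* The Cauchy estimate multiplies this tolerance by [R4], giving c eps / 2, below the lower bound c
   eps at the chosen point. *)
destruct (P3 (c * eps / (2 * R4))) as [N HN].
{ apply Rdiv_lt_0_compat; [apply Rmult_lt_0_compat|]; lra. }
specialize (HN N (Nat.le_refl N)).
destruct (Hp (phi N)) as (Z1 & _ & Z2 & Z3). set (z := fst (p (phi N))) in *.
destruct (Hhs (phi N)) as [HS Hd].
assert (Q : weight (b + 1) z * Cmod (test_der a (snd (p (phi N))) z * g z)%C <= R4 * (c * eps / (2 * R4))).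
{ apply (weighted_cauchy_estimate b _ (hs (phi N))); auto.
  - apply (IsSg_holo g _ _ HS).
  - intros w Hw. apply inD_Cmod in Hw. specialize (HN w Hw). rewrite (H0 w Hw) in HN.
    now replace (hs (phi N) w - 0)%C with (hs (phi N) w) in HN by ring. }
replace (b + 1) with ((a + 1) + (b - a)) in Q by ring. rewrite weight_plus, Cmod_mult in Q.
assert (Q' : c * eps <= (weight (a + 1) z * Cmod (test_der a (snd (p (phi N))) z)) *
   (weight (b - a) z * Cmod (g z))) by (apply Rmult_le_compat; (assumption || lra)).
replace (R4 * (c * eps / (2 * R4))) with (c * eps / 2) in Q by (field; lra).
assert (0 < c * eps) by (now apply Rmult_lt_0_compat). lra.
Qed.

Theorem theorem5 (g : Cx -> Cx) (alpha beta : R)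
  (Hg : holoD g) (Ha : 0 <= alpha) (Hb : 0 <= beta) :
  (Sg_compact g alpha 0 <-> (forall z : Cx, inD z -> g z = C0)) /\
  (0 < beta -> (Sg_compact g alpha beta <-> weighted_lim0 g alpha beta)).
Proof.
split; [split|intros Hb0; split].
- intros H z Hz. apply vanish_at_boundary; auto; [|now apply inD_Cmod].
  intros eps Heps.
  destruct (lim_of_Sg_compact alpha 0 g Hg Ha (Rle_refl 0) H eps Heps) as [r [Hr1 Hr]].
  exists r. split; auto. intros w Hw.
  specialize (Hr w). rewrite Cmod_Complex in Hr. specialize (Hr Hw).
  rewrite Cmod_Complex in Hr.
  (* A nonpositive power of 1 - |w|^2 is at least 1, so the weighted limit implies that g itself
     tends to 0 at the circle. *)
  assert (W : 1 <= weight (0 - alpha) w).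
  { pose proof (weight_le_1 alpha w Ha (proj2 Hw)) as W. pose proof (weight_pos alpha w) as W0.
    pose proof (weight_plus alpha (0 - alpha) w) as E.
    replace (alpha + (0 - alpha)) with 0 in E by ring.
    assert (E0 : weight 0 w = 1) by (unfold weight, Rpower; rewrite Rmult_0_l; apply exp_0).
    pose proof (weight_pos (0 - alpha) w). nra. }
  pose proof (Cmod_ge_0 (g w)). nra.
- intros H. apply Sg_compact_zero; auto. lra.
- intros H. now apply lim_of_Sg_compact.
- intros H. now apply Sg_compact_of_lim.
Qed.
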